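(* Let $(M,g,N)\to(\overline M,\overline g)$ be a closed rigged null hypersurface. (1) Let $\alpha$ be a nowhere vanishing smooth function on $M$ that is constant on each leaf of the screen distribution $\mathcal S(TM)$. Then the induced connection $\nabla$ is the Levi-Civita connection of the $\alpha$-associated metric $g_\alpha=g+\alpha\,\eta\otimes\eta$ if and only if $$\stackrel{\star}{A}_\xi=\alpha A_N\quad\text{and}\quad 2\alpha\,\tau(\xi)+d\alpha(\xi)=0 .$$ (2) Let $\alpha$ be a nonzero real number. Then the induced connection $\nabla$ is the Levi-Civita connection of $g_\alpha=g+\alpha\,\eta\otimes\eta$ if and only if $$\stackrel{\star}{A}_\xi=\alpha A_N\quad\text{and}\quad \tau\equiv 0 .$$
   Context: All manifolds are smooth and connected. $(\overline M,\overline g)$ is an $(n+1)$-dimensional semi-Riemannian manifold of index $q>0$ with Levi-Civita connection $\overline\nabla$. $M\subset\overline M$ is an embedded hypersurface with inclusion $x$, and $g=x^\star\overline g$ is degenerate at every point ($M$ is a null hypersurface). A null rigging for $M$ is a vector field $N$ on an open subset of $\overline M$ containing $M$ such that, for every $p\in M$, $N_p\notin T_pM$ and $N_p$ is lightlike (nonzero and $\overline g(N_p,N_p)=0$); $(M,g,N)$ is then called a rigged null hypersurface. Put $\overline\eta=\overline g(N,\cdot)$ and $\eta=x^\star\overline\eta$. The screen distribution is $\mathcal S(TM)=\ker\eta\subset TM$. The rigged vector field $\xi$ is the unique section of the radical bundle $TM^\perp=\{X\in TM: g(X,Y)=0\ \forall Y\in TM\}$ with $\overline g(\xi,N)=1$.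 $P$ is the projection of $TM$ onto $\mathcal S(TM)$ along $\xi$. One has $T\overline M|_M=TM\oplus\mathrm{span}(N)$. The induced connection $\nabla$ on $M$, the second fundamental form $B$, the shape operators $A_N,\stackrel{\star}{A}_\xi$ (with values in $\mathcal S(TM)$) and the rotation $1$-form $\tau$ are defined, for $X,Y\in\Gamma(TM)$, by $$\overline\nabla_XY=\nabla_XY+B(X,Y)N,\quad \overline\nabla_XN=-A_NX+\tau(X)N,\quad \nabla_X\xi=-\stackrel{\star}{A}_\xi X-\tau(X)\xi .$$ $(M,g,N)$ is closed if $d\eta=0$ on $M$; then $\mathcal S(TM)$ is integrable. For nowhere vanishing $\alpha$, $g_\alpha$ is a non-degenerate metric on $M$. *)

(* Defs.v *)
From HB Require Import structures.
From mathcomp Require Import all_boot all_order all_algebra.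
From mathcomp Require Import all_classical all_reals all_analysis.
Import Order.TTheory GRing.Theory Num.Theory.
Import numFieldNormedType.Exports.
Set Implicit Arguments.
Unset Strict Implicit.
Unset Printing Implicit Defensive.
Local Open Scope classical_set_scope.
Local Open Scope ring_scope.

(* f is C^(k+1) when it is Fréchet differentiable and all its directional
   derivatives are C^k. Meant for open U. *)
Fixpoint Ck_on (R : realType) (n : nat) (V : normedModType R) (k : nat)
    (U : set 'rV[R]_n) (f : 'rV[R]_n -> V) : Prop :=
  match k with
  | 0%N => forall a, U a -> {for a, continuous f}
  | j.+1 => (forall a, U a -> differentiable f a) /\
            (forall v : 'rV[R]_n, Ck_on j U (fun a => 'D_v f a : V))
  end.

Definition Cinfty_on (R : realType) (n : nat) (V : normedModType R)
    (U : set 'rV[R]_n) (f : 'rV[R]_n -> V) : Prop :=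
  forall k, Ck_on k U f.

(* The atlas is given as one preferred chart around each point: [coord c] is the
   chart at c, meaningful on the open set [cdom c], and [cinv c] is its inverse,
   meaningful on [coord c @` cdom c].
   The tangent space at p is 'rV[R]_n, read in the preferred chart at p; hence
   a vector field is a function M -> 'rV[R]_n. *)
Record manifold (R : realType) (n : nat) := Manifold {
  carrier :> topologicalType;
  cdom : carrier -> set carrier;
  coord : carrier -> carrier -> 'rV[R]_n;
  cinv : carrier -> 'rV[R]_n -> carrier;
  manifold_hausdorff : hausdorff_space carrier;
  manifold_second_countable : @second_countable carrier;
  manifold_connected : connected [set: carrier];
  cdom_center : forall c, cdom c c;
  cdom_open : forall c, open (cdom c);
  cimg_open : forall c, open (coord c @` cdom c);
  coordK : forall c p, cdom c p -> cinv c (coord c p) = p;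
  coord_continuous : forall c p, cdom c p -> {for p, continuous (coord c)};
  cinv_continuous : forall c a, (coord c @` cdom c) a ->
    {for a, continuous (cinv c)};
  transition_smooth : forall c c',
    Cinfty_on (coord c @` (cdom c `&` cdom c')) (coord c' \o cinv c)
}.
Arguments cdom {R n m} c : rename.
Arguments coord {R n m} c _ : rename.
Arguments cinv {R n m} c _ : rename.

Definition smooth_on (R : realType) (n : nat) (M : manifold R n)
    (V : normedModType R) (U : set M) (f : M -> V) : Prop :=
  forall c : M, Cinfty_on (coord c @` (cdom c `&` U)) (f \o cinv c).

(* v(f), the derivative at p of f in the direction of the tangent vector v *)
Definition dirder (R : realType) (n : nat) (M : manifold R n)
    (V : normedModType R) (f : M -> V) (p : M) (v : 'rV[R]_n) : V :=
  'D_v (f \o cinv p) (coord p p).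

Definition smooth_map (R : realType) (m n : nat) (M : manifold R m)
    (M' : manifold R n) (x : M -> M') : Prop :=
  continuous x /\ forall c : M', smooth_on (x @^-1` cdom c) (coord c \o x).

Definition dmap (R : realType) (m n : nat) (M : manifold R m)
    (M' : manifold R n) (x : M -> M') (p : M) (v : 'rV[R]_m) : 'rV[R]_n :=
  dirder (coord (x p) \o x) p v.

Definition immersion (R : realType) (m n : nat) (M : manifold R m)
    (M' : manifold R n) (x : M -> M') : Prop :=
  smooth_map x /\ forall p, injective (dmap x p).

(* The last clause says that x is open onto its image. *)
Definition embedding (R : realType) (m n : nat) (M : manifold R m)
    (M' : manifold R n) (x : M -> M') : Prop :=
  [/\ immersion x, injective x &
      forall U : set M, open U -> exists2 V : set M', open V & x @^-1` V = U].

(* Smoothness over U of a section Z of the pullback bundle x^*TM', that is of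
   a vector field along x, with Z p in the tangent space at x p: it acts on
   smooth functions of M' to give smooth functions of M. *)
Definition smooth_along (R : realType) (m n : nat) (M : manifold R m)
    (M' : manifold R n) (x : M -> M') (U : set M) (Z : M -> 'rV[R]_n) : Prop :=
  forall (V : set M') (f : M' -> R), open V -> smooth_on V f ->
    smooth_on (U `&` x @^-1` V) (fun p => dirder f (x p) (Z p)).

Definition smooth_field (R : realType) (n : nat) (M : manifold R n)
    (U : set M) (X : M -> 'rV[R]_n) : Prop :=
  smooth_along (@idfun M) U X.

(* The components of [X, Y] at p are the values of XY - YX on the
   coordinate functions of the chart at p. *)
Definition lie_bracket (R : realType) (n : nat) (M : manifold R n)
    (X Y : M -> 'rV[R]_n) (p : M) : 'rV[R]_n :=
  dirder (fun q => dirder (coord p) q (Y q)) p (X p) -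
  dirder (fun q => dirder (coord p) q (X q)) p (Y p).

Definition one_form (R : realType) (n : nat) (M : manifold R n) :=
  M -> 'rV[R]_n -> R.

Definition closed_form (R : realType) (n : nat) (M : manifold R n)
    (w : one_form M) : Prop :=
  forall (U : set M) (X Y : M -> 'rV[R]_n) (p : M),
    open U -> smooth_field U X -> smooth_field U Y -> U p ->
    dirder (fun q => w q (Y q) : R) p (X p)
    - dirder (fun q => w q (X q) : R) p (Y p)
    - w p (lie_bracket X Y p) = 0.

Definition tensor2 (R : realType) (n : nat) (M : manifold R n) :=
  M -> 'rV[R]_n -> 'rV[R]_n -> R.

Definition negative_definite_on (R : realType) (n : nat)
    (b : 'rV[R]_n -> 'rV[R]_n -> R) (W : {vspace 'rV[R]_n}) : Prop :=
  forall u, u \in W -> u != 0 -> b u u < 0.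

Record semi_riemannian (R : realType) (n : nat) (M : manifold R n)
    (q : nat) (g : tensor2 M) : Prop := SemiRiemannian {
  metric_linear : forall p a u v w, g p (a *: u + v) w = a * g p u w + g p v w;
  metric_sym : forall p u v, g p u v = g p v u;
  metric_smooth : forall (U : set M) X Y, open U ->
    smooth_field U X -> smooth_field U Y ->
    smooth_on U (fun p => g p (X p) (Y p) : R);
  metric_nondegenerate : forall p u, (forall v, g p u v = 0) -> u = 0;
  metric_index : forall p,
    (exists2 W : {vspace 'rV[R]_n},
       negative_definite_on (g p) W & \dim W = q) /\
    (forall W : {vspace 'rV[R]_n},
       negative_definite_on (g p) W -> (\dim W <= q)%N)
}.

(* Connections on the pullback bundle x^*TM', as operators taking a tangent
   vector of M at p and a section of x^*TM' defined and smooth near p. Sections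
   are represented by total functions, whence the locality axiom; nothing is
   said about functions which are not smooth near p. *)
Record connection_along (R : realType) (m n : nat) (M : manifold R m)
    (M' : manifold R n) (x : M -> M') := ConnectionAlong {
  cov :> M -> 'rV[R]_m -> (M -> 'rV[R]_n) -> 'rV[R]_n;
  cov_linear : forall (U : set M) Z p a u v, open U -> smooth_along x U Z ->
    U p -> cov p (a *: u + v) Z = a *: cov p u Z + cov p v Z;
  cov_add : forall (U : set M) Z Z' p v, open U -> smooth_along x U Z ->
    smooth_along x U Z' -> U p ->
    cov p v (fun q => Z q + Z' q) = cov p v Z + cov p v Z';
  cov_leibniz : forall (U : set M) (f : M -> R) Z p v, open U ->
    smooth_on U f -> smooth_along x U Z -> U p ->
    cov p v (fun q => f q *: Z q) = dirder f p v *: Z p + f p *: cov p v Z;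
  cov_local : forall (U : set M) Z Z' p v, open U -> smooth_along x U Z ->
    smooth_along x U Z' -> {in U, Z =1 Z'} -> U p -> cov p v Z = cov p v Z';
  cov_smooth : forall (U : set M) X Z, open U -> smooth_field U X ->
    smooth_along x U Z -> smooth_along x U (fun p => cov p (X p) Z)
}.

Definition affine_connection (R : realType) (n : nat) (M : manifold R n) :=
  connection_along (@idfun M).

Definition levi_civita (R : realType) (n : nat) (M : manifold R n)
    (g : tensor2 M) (D : affine_connection M) : Prop :=
  (forall (U : set M) X Y p, open U -> smooth_field U X -> smooth_field U Y ->
     U p -> D p (X p) Y - D p (Y p) X = lie_bracket X Y p) /\
  (forall (U : set M) Y Z p v, open U -> smooth_field U Y ->
     smooth_field U Z -> U p ->
     dirder (fun q => g q (Y q) (Z q) : R) p v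
     = g p (D p v Y) (Z p) + g p (Y p) (D p v Z)).

(* Dx is the connection induced on x^*TM' by the connection D of M'. This is
   what gives a meaning to the derivative, with respect to a tangent vector
   of a submanifold, of a field defined on the submanifold only. *)
Definition pullback_connection (R : realType) (m n : nat) (M : manifold R m)
    (M' : manifold R n) (x : M -> M') (D : affine_connection M')
    (Dx : connection_along x) : Prop :=
  forall (V : set M') (Z : M' -> 'rV[R]_n) p v, open V -> smooth_field V Z ->
    V (x p) -> Dx p v (Z \o x) = D (x p) (dmap x p v) Z.

Definition induced_tensor (R : realType) (m n : nat) (M : manifold R m)
    (M' : manifold R n) (x : M -> M') (g : tensor2 M') : tensor2 M :=
  fun p u v => g (x p) (dmap x p u) (dmap x p v).

Definition null_hypersurface (R : realType) (n : nat) (M : manifold R n)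
    (Mb : manifold R n.+1) (x : M -> Mb) (gb : tensor2 Mb) : Prop :=
  embedding x /\
  forall p, exists2 u, u != 0 & forall v, induced_tensor x gb p u v = 0.

Record null_rigging (R : realType) (n : nat) (M : manifold R n)
    (Mb : manifold R n.+1) (x : M -> Mb) (gb : tensor2 Mb)
    (Om : set Mb) (N : Mb -> 'rV[R]_n.+1) : Prop := NullRigging {
  rigging_dom_open : open Om;
  rigging_dom_sub : range x `<=` Om;
  rigging_smooth : smooth_field Om N;
  rigging_transverse : forall p, ~ range (dmap x p) (N (x p));
  rigging_lightlike : forall p,
    N (x p) != 0 /\ gb (x p) (N (x p)) (N (x p)) = 0
}.

Definition rigging_form (R : realType) (n : nat) (M : manifold R n)
    (Mb : manifold R n.+1) (x : M -> Mb) (gb : tensor2 Mb)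
    (N : Mb -> 'rV[R]_n.+1) : one_form M :=
  fun p v => gb (x p) (N (x p)) (dmap x p v).

Definition rigged_field (R : realType) (n : nat) (M : manifold R n)
    (Mb : manifold R n.+1) (x : M -> Mb) (gb : tensor2 Mb)
    (N : Mb -> 'rV[R]_n.+1) (xi : M -> 'rV[R]_n) : Prop :=
  [/\ smooth_field setT xi,
      forall p v, induced_tensor x gb p (xi p) v = 0 &
      forall p, gb (x p) (dmap x p (xi p)) (N (x p)) = 1].

Definition kernel_distribution (R : realType) (n : nat) (M : manifold R n)
    (w : one_form M) : M -> set 'rV[R]_n :=
  fun p => [set v | w p v = 0].

Definition integral_manifold (R : realType) (k n : nat) (L : manifold R k)
    (M : manifold R n) (S : M -> set 'rV[R]_n) (j : L -> M) : Prop :=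
  [/\ immersion j, injective j & forall q, range (dmap j q) = S (j q)].

(* The leaf through p, as the union of all the (connected, immersed) integral
   manifolds of S which contain p. *)
Definition leaf (R : realType) (n : nat) (M : manifold R n)
    (S : M -> set 'rV[R]_n) (p : M) : set M :=
  [set y | exists (k : nat) (L : manifold R k) (j : L -> M),
     [/\ integral_manifold S j, range j p & range j y]].

(* Gauss and Weingarten formulas: [nabla] is the induced connection, [B] the
   second fundamental form, [AN] and [Axi] the shape operators of N and of xi
   and [tau] the rotation form; these formulas determine them. *)
Record induced_objects (R : realType) (n : nat) (M : manifold R n)
    (Mb : manifold R n.+1) (x : M -> Mb) (gb : tensor2 Mb)
    (Db : affine_connection Mb) (Dx : connection_along x)
    (N : Mb -> 'rV[R]_n.+1) (xi : M -> 'rV[R]_n)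
    (nabla : affine_connection M) (B : tensor2 M)
    (AN Axi : M -> 'rV[R]_n -> 'rV[R]_n) (tau : one_form M) : Prop :=
  InducedObjects {
  gauss_formula : forall (U : set M) Y p v, open U -> smooth_field U Y -> U p ->
    Dx p v (fun q => dmap x q (Y q))
    = dmap x p (nabla p v Y) + B p v (Y p) *: N (x p);
  weingarten_formula : forall p v,
    Db (x p) (dmap x p v) N = - dmap x p (AN p v) + tau p v *: N (x p);
  weingarten_formula_xi : forall p v,
    nabla p v xi = - Axi p v - tau p v *: xi p;
  AN_screen : forall p v,
    kernel_distribution (rigging_form x gb N) p (AN p v);
  Axi_screen : forall p v,
    kernel_distribution (rigging_form x gb N) p (Axi p v)
}.

Definition associated_metric (R : realType) (n : nat) (M : manifold R n)
    (Mb : manifold R n.+1) (x : M -> Mb) (gb : tensor2 Mb)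
    (N : Mb -> 'rV[R]_n.+1) (alpha : M -> R) : tensor2 M :=
  fun p u v => induced_tensor x gb p u v
    + alpha p * (rigging_form x gb N p u * rigging_form x gb N p v).

(* Main.v *)
(** The induced connection is torsion free, and the Gauss and Weingarten
formulas give, with C(v, Y) = g(Axi v - alpha AN v, Y),
  (nabla_v g_alpha)(Y, Z) = C(v, Y) eta(Z) + C(v, Z) eta(Y)
     + (d alpha(v) + 2 alpha tau(v)) eta(Y) eta(Z).
Since C(v, xi) = 0 and g is non-degenerate on the screen, nabla is the
Levi-Civita connection of g_alpha if and only if Axi = alpha AN and
d alpha + 2 alpha tau = 0. It remains to see that, when Axi = alpha AN, the last
equation holds automatically on the screen. There d eta = 0 gives
tau(v) = - g(AN xi, v), and alpha AN xi = Axi xi = 0. Finally d alpha vanishes on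
the screen because through every point there is a leaf: locally eta = df by the
Poincare lemma, and the level set of f is a graph by the implicit function
theorem. *)
Require Import Defs.
From HB Require Import structures.
From mathcomp Require Import all_boot all_order all_algebra.
From mathcomp Require Import all_classical all_reals all_analysis.
From mathcomp Require Import ring lra.
Import Order.TTheory GRing.Theory Num.Theory.
Import numFieldNormedType.Exports.
Import Defs(coord, metric_sym).
Local Open Scope classical_set_scope.
Local Open Scope ring_scope.
Set Implicit Arguments.
Unset Strict Implicit.
Unset Printing Implicit Defensive.

(** * Maps of class C^k *)

Section Ck.
Context {R : realType}.
Implicit Types V W : normedModType R.

(** Two gaps shape the development. [Dx] is prescribed only on restrictions [Z \o x] of ambient
    fields, while the Gauss formula applies it to fields [dmap x q (Y q)] that live on M alone;
    metric compatibility and the torsion identity are extended to all sections along x by expanding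
    them in pulled-back chart frames. And constancy of alpha on leaves says something about d alpha
    only if every screen vector is tangent to an actual integral manifold, so a leaf has to be built
    as an object of type [manifold], with its atlas and countable base. The primitive of eta is an
    integral along rays. Differentiation under the integral yields its directional derivatives only,
    and the differential is recovered from the continuity of the coefficients. The graph is taken in
    the direction of xi, where df(xi) = eta(xi) = 1. In part (2), d alpha = 0 and the scalar
    equation reads 2 alpha tau = 0, in all directions at once. *)

Lemma linear_subr (U V : lmodType R) (f : U -> V) : linear f ->
  forall a b, f (a - b) = f a - f b.
Proof. by move=> L a b; have := L (-1) b a; rewrite !scaleN1r => E; rewrite addrC E addrC. Qed.

Lemma linear_zero (U V : lmodType R) (f : U -> V) : linear f -> f 0 = 0.
Proof. by move=> L; rewrite -[0 in LHS](subrr (0 : U)) linear_subr// subrr. Qed.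

Lemma linear_scale (U V : lmodType R) (f : U -> V) : linear f ->
  forall k a, f (k *: a) = k *: f a.
Proof. by move=> L k a; have := L k a 0; rewrite !addr0 (linear_zero L) addr0. Qed.

Lemma linear_plus (U V : lmodType R) (f : U -> V) : linear f ->
  forall a b, f (a + b) = f a + f b.
Proof. by move=> L a b; have := L 1 a b; rewrite !scale1r. Qed.

Lemma linear_big (U V : lmodType R) (f : U -> V) (I : Type) (r : seq I) (g : I -> U) :
  linear f -> f (\sum_(i <- r) g i) = \sum_(i <- r) f (g i).
Proof.
move=> L; elim: r => [|i r IH]; first by rewrite !big_nil (linear_zero L).
by rewrite !big_cons (linear_plus L) IH.
Qed.

(** The little-o definition of the differential in terms of explicit epsilons, so that a linear map
    built by hand can be certified by norm estimates. *)
Lemma is_diff_eps V W (f : V -> W) a (L : {linear V -> W}) :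
  continuous L ->
  (forall e, 0 < e -> \forall h \near (0 : V),
     `|f (h + a) - f a - L h| <= e * `|h|) ->
  is_diff a f L.
Proof.
move=> Lc H.
have E : f \o shift a = cst (f a) + L +o_ 0 id.
  apply/eqaddoP => e e0; have := H e e0; apply: filterS => h.
  by rewrite /= opprD addrA.
have dL := diff_unique Lc E.
apply: DiffDef => //; apply/diff_locallyP; rewrite dL; split => //.
Qed.

Lemma differentiable_eps V W (f : V -> W) a : differentiable f a ->
  forall e, 0 < e -> \forall h \near (0 : V),
     `|f (h + a) - f a - 'd f a h| <= e * `|h|.
Proof.
move=> /diff_locallyP[_ /eqaddoP E] e e0.
by have := E e e0; apply: filterS => h /=; rewrite opprD addrA.
Qed.

Lemma near_eq_differentiable V W (f g : V -> W) a :
  (\near a, f a = g a) -> differentiable f a -> differentiable g a.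
Proof.
move=> fg df; suff H : is_diff a g ('d f a) by exact: ex_diff.
apply: is_diff_eps; first exact: diff_continuous.
move=> e e0; near=> h.
have <- : f a = g a by exact: nbhs_singleton fg.
have <- : f (h + a) = g (h + a).
  near: h; move: fg; rewrite (near_shift 0) subr0; exact.
by near: h; exact: differentiable_eps.
Unshelve. all: by end_near. Qed.

Lemma open_near_eq (T : topologicalType) (U : Type) (A : set T) (f g : T -> U) a :
  open A -> A a -> (forall b, A b -> f b = g b) -> \near a, f a = g a.
Proof. by move=> oA Aa fg; apply: filterS fg _; exact: open_nbhs_nbhs. Qed.

Lemma derive_linear V W (f : V -> W) a : differentiable f a ->
  linear (fun v => 'D_v f a).
Proof. by move=> df k u v; rewrite !deriveE// linearP. Qed.

Lemma Ck_sub n V k (U U' : set 'rV[R]_n) (f : 'rV[R]_n -> V) :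
  U' `<=` U -> Ck_on k U f -> Ck_on k U' f.
Proof.
elim: k f => [|k IH] f sU /=; first by move=> h a /sU /h.
by case=> h1 h2; split=> [a /sU/h1//|v]; exact: IH.
Qed.

Lemma Ck_pred n V k (U : set 'rV[R]_n) (f : 'rV[R]_n -> V) :
  Ck_on k.+1 U f -> Ck_on k U f.
Proof.
elim: k f => [|k IH] f /=; first by case=> h _ a /h; exact: differentiable_continuous.
by case=> h1 h2; split=> // v; exact/IH.
Qed.

Lemma Ck_local n V k (U : set 'rV[R]_n) (f : 'rV[R]_n -> V) :
  (forall a, U a -> exists2 W, W a & Ck_on k W f) -> Ck_on k U f.
Proof.
elim: k f => [|k IH] f /= h.
  by move=> a /h[W Wa cf]; exact: cf.
split=> [a /h[W Wa [h1 _]]|v]; first exact: h1.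
by apply: IH => a /h[W Wa [_ h2]]; exists W.
Qed.

(** Openness of U turns equality on U into equality near each point, which passes to all
    derivatives. *)
Lemma Ck_eq n V k (U : set 'rV[R]_n) (f g : 'rV[R]_n -> V) :
  open U -> (forall a, U a -> f a = g a) -> Ck_on k U f -> Ck_on k U g.
Proof.
move=> oU; elim: k f g => [|k IH] f g fg /=.
  move=> h a Ua; have ne := open_near_eq oU Ua fg.
  have fa : f @ a --> f a := h a Ua.
  suff : g @ a --> g a by [].
  rewrite -(fg a Ua); apply: cvg_trans fa; exact: (@near_eq_cvg _ _ (nbhs a) _ f g ne).
case=> h1 h2; split=> [a Ua|v].
  exact: near_eq_differentiable (open_near_eq oU Ua fg) (h1 a Ua).
apply: IH (h2 v) => a Ua; apply: near_eq_derive.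
exact: open_near_eq oU Ua fg.
Qed.

Lemma Ck_cst n V k (U : set 'rV[R]_n) (c : V) : Ck_on k U (cst c).
Proof.
elim: k c => [|k IH] c /=; first by move=> a _; exact: (@cvg_cst _ _ _ (nbhs a)).
split=> [a _|v]; first exact: differentiable_cst.
have -> : (fun a => 'D_v (cst c) a) = cst (0 : V).
  by apply/funext => a; exact: derive_cst.
exact: IH.
Qed.

Lemma Ck_add n V k (U : set 'rV[R]_n) (f g : 'rV[R]_n -> V) :
  open U -> Ck_on k U f -> Ck_on k U g -> Ck_on k U (fun a => f a + g a).
Proof.
move=> oU; elim: k f g => [|k IH] f g /=.
  by move=> cf cg a Ua; exact: cvgD (cf a Ua) (cg a Ua).
case=> f1 f2 [g1 g2]; split=> [a Ua|v].
  exact: differentiableD (f1 a Ua) (g1 a Ua).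
apply: Ck_eq oU _ (IH _ _ (f2 v) (g2 v)) => a Ua.
by rewrite [RHS]deriveD//; apply: diff_derivable; [exact: f1|exact: g1].
Qed.

Lemma continuous_linear_rV n W (L : {linear 'rV[R]_n -> W}) : continuous L.
Proof.
have -> : L = (fun u : 'rV[R]_n => \sum_i u 0 i *: L (delta_mx 0 i)) :> (_ -> _).
  apply/funext => u; rewrite {1}[u]row_sum_delta linear_sum.
  by apply: eq_bigr => i _; rewrite linearZ.
move=> a; rewrite /continuous_at.
elim: (index_enum _) => [|i r IH].
  by rewrite big_nil; under eq_fun do rewrite big_nil; exact: (@cvg_cst _ _ _ (nbhs a)).
rewrite big_cons; under eq_fun do rewrite big_cons.
apply: cvgD IH; apply: cvgZ; last exact: (@cvg_cst _ _ _ (nbhs a)).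
exact: coord_continuous.
Qed.

Fact scale_bilinear W : bilinear_for
    (GRing.Scale.Law.clone _ _ *:%R _) (GRing.Scale.Law.clone _ _ *:%R _)
    (@GRing.scale R W : R -> W -> W).
Proof.
split=> [u'|u] a x y /=.
- by rewrite scalerDl scalerA.
- by rewrite scalerDr !scalerA mulrC.
Qed.

(** The product rule for a scalar and a vector factor is the differential of a continuous bilinear
    map composed with a pairing. *)
Lemma is_diff_scale V W (f : V -> R) (g : V -> W) a :
  differentiable f a -> differentiable g a ->
  is_diff a (fun x => f x *: g x) (fun h => f a *: 'd g a h + 'd f a h *: g a).
Proof.
move=> df dg.
pose bM := bilinear_isBilinear.Build R R W W _ _ (@GRing.scale R W) (@scale_bilinear W).
pose b : {bilinear R -> W -> W} := HB.pack (@GRing.scale R W) bM.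
have bc : continuous (fun p : R * W => b p.1 p.2) by move=> p; exact: scale_continuous.
have db := differentiable_bilin (f a, g a) bc.
have dp := differentiable_pair df dg.
have -> : (fun x => f x *: g x) = (fun p : R * W => b p.1 p.2) \o (fun y => (f y, g y)) by [].
apply: DiffDef; first exact: differentiable_comp.
by rewrite diff_comp// diff_bilin// diff_pair.
Qed.

Lemma differentiable_scale V W (f : V -> R) (g : V -> W) a :
  differentiable f a -> differentiable g a -> differentiable (fun x => f x *: g x) a.
Proof. by move=> df dg; exact: (@ex_diff _ _ _ _ _ _ _ (is_diff_scale df dg)). Qed.

Lemma derive_scale V W (f : V -> R) (g : V -> W) a v :
  differentiable f a -> differentiable g a ->
  'D_v (fun x => f x *: g x) a = f a *: 'D_v g a + 'D_v f a *: g a.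
Proof.
move=> df dg; rewrite !deriveE//; last exact: differentiable_scale.
by have [_ ->] := is_diff_scale df dg.
Qed.

Lemma Ck_scale n V k (U : set 'rV[R]_n) (f : 'rV[R]_n -> R) (g : 'rV[R]_n -> V) :
  open U -> Ck_on k U f -> Ck_on k U g -> Ck_on k U (fun a => f a *: g a).
Proof.
move=> oU; elim: k f g => [|k IH] f g.
  by move=> cf cg a Ua; exact: cvgZ (cf a Ua) (cg a Ua).
move=> Cf Cg; have [f1 f2] := Cf; have [g1 g2] := Cg.
split=> [a Ua|v]; first exact: differentiable_scale (f1 a Ua) (g1 a Ua).
have [fk gk] := (Ck_pred Cf, Ck_pred Cg).
apply: Ck_eq oU _ (Ck_add oU (IH _ _ fk (g2 v)) (IH _ _ (f2 v) gk)) => a Ua.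
by rewrite derive_scale; [|exact: f1|exact: g1].
Qed.

Lemma Ck_linear_comp n V W k (U : set 'rV[R]_n) (L : {linear V -> W}) (f : 'rV[R]_n -> V) :
  continuous L -> open U -> Ck_on k U f -> Ck_on k U (L \o f).
Proof.
move=> Lc oU; elim: k f => [|k IH] f.
  by move=> cf a Ua; apply: continuous_comp; [exact: cf|exact: Lc].
have dL b : differentiable L b by exact: linear_differentiable.
case=> f1 f2; split=> [a Ua|v]; first exact: differentiable_comp (f1 a Ua) (dL _).
apply: Ck_eq oU _ (IH _ (f2 v)) => a Ua /=.
have fa := f1 a Ua.
have -> : 'D_v (L \o f) a = 'd (L \o f) a v by rewrite deriveE//; exact: differentiable_comp.
by rewrite diff_comp// deriveE//= (diff_lin _ Lc).
Qed.

Lemma derive_linear_comp V V' W (L : {linear V' -> W}) (f : V -> V') a v :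
  continuous L -> differentiable f a -> 'D_v (L \o f) a = L ('D_v f a).
Proof.
move=> Lc df; have dL := linear_differentiable _ Lc.
have -> : 'D_v (L \o f) a = 'd (L \o f) a v by rewrite deriveE//; exact: differentiable_comp.
by rewrite diff_comp// deriveE//= (diff_lin _ Lc).
Qed.

Lemma Ck_sum n V k (U : set 'rV[R]_n) (I : Type) (r : seq I) (f : I -> 'rV[R]_n -> V) :
  open U -> (forall i, Ck_on k U (f i)) -> Ck_on k U (fun a => \sum_(i <- r) f i a).
Proof.
move=> oU Cf; elim: r => [|i r IH].
  have -> : (fun a => \sum_(i <- [::]) f i a) = cst 0 by apply/funext => a; rewrite big_nil.
  exact: Ck_cst.
have -> : (fun a => \sum_(j <- i :: r) f j a) = (fun a => f i a + \sum_(j <- r) f j a).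
  by apply/funext => a; rewrite big_cons.
exact: Ck_add.
Qed.

Definition coordl n (i : 'I_n) (u : 'rV[R]_n) : R := u 0 i.
Fact coordl_linear n (i : 'I_n) : linear (coordl i).
Proof. by move=> a u v; rewrite /coordl !mxE. Qed.
HB.instance Definition _ n (i : 'I_n) :=
  GRing.isLinear.Build R 'rV[R]_n R _ (coordl i) (coordl_linear i).

Lemma Ck_coord n m k (U : set 'rV[R]_n) (f : 'rV[R]_n -> 'rV[R]_m) i :
  open U -> Ck_on k U f -> Ck_on k U (fun a => f a 0 i).
Proof.
by move=> oU; apply: (@Ck_linear_comp _ _ _ _ _ (coordl i)) => //; exact: continuous_linear_rV.
Qed.

Lemma derive_coord V m (f : V -> 'rV[R]_m) a v i :
  differentiable f a -> 'D_v (fun x => f x 0 i) a = 'D_v f a 0 i.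
Proof. by apply: (@derive_linear_comp _ _ _ (coordl i)); exact: continuous_linear_rV. Qed.

Lemma Ck_rV n m k (U : set 'rV[R]_n) (f : 'rV[R]_n -> 'rV[R]_m) :
  open U -> (forall i, Ck_on k U (fun a => f a 0 i)) -> Ck_on k U f.
Proof.
move=> oU Cf.
have -> : f = (fun a => \sum_i f a 0 i *: delta_mx 0 i).
  by apply/funext => a; rewrite -row_sum_delta.
by apply: Ck_sum => // i; apply: Ck_scale => //; exact: Ck_cst.
Qed.

Lemma derive_comp V V' W (f : V -> V') (g : V' -> W) a v :
  differentiable f a -> differentiable g (f a) ->
  'D_v (g \o f) a = 'D_('D_v f a) g (f a).
Proof.
move=> df dg; rewrite (deriveE _ (differentiable_comp df dg)) diff_comp//=.
by rewrite (deriveE _ dg) (deriveE _ df).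
Qed.

Lemma derive_sum_delta n W (g : 'rV[R]_n -> W) a (u : 'rV[R]_n) : differentiable g a ->
  'D_u g a = \sum_i u 0 i *: 'D_(delta_mx 0 i) g a.
Proof.
move=> dg; rewrite deriveE// {1}[u]row_sum_delta linear_sum.
by apply: eq_bigr => i _; rewrite linearZ deriveE.
Qed.

(** The chain rule differentiates g in the moving direction ['D_v f a], while [Ck_on] speaks of
    fixed directions. Expanding that direction over the standard basis gives a finite sum of
    products, each within reach of the induction. *)
Lemma Ck_comp n m V k (U : set 'rV[R]_n) (U' : set 'rV[R]_m)
  (f : 'rV[R]_n -> 'rV[R]_m) (g : 'rV[R]_m -> V) :
  open U -> open U' -> (forall a, U a -> U' (f a)) ->
  Ck_on k U f -> Ck_on k U' g -> Ck_on k U (g \o f).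
Proof.
move=> oU oU' fU; elim: k f fU g => [|k IH] f fU g.
  by move=> cf cg a Ua; apply: continuous_comp; [exact: cf|exact/cg/fU].
move=> Cf [g1 g2]; have [f1 f2] := Cf.
split=> [a Ua|v]; first exact: differentiable_comp (f1 a Ua) (g1 _ (fU a Ua)).
suff H : Ck_on k U (fun a => \sum_i ('D_v f a) 0 i *: ('D_(delta_mx 0 i) g \o f) a).
  apply: Ck_eq oU _ H => a Ua /=.
  have fa := f1 a Ua; have ga := g1 _ (fU a Ua).
  by rewrite (derive_comp _ fa ga) (derive_sum_delta _ ga).
apply: Ck_sum => // i; apply: Ck_scale => //; first exact: (Ck_coord _ oU (f2 v)).
by apply: IH => //; [exact: Ck_pred|exact: g2].
Qed.

Lemma Ck_inv n k (U : set 'rV[R]_n) (f : 'rV[R]_n -> R) :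
  open U -> (forall a, U a -> f a != 0) -> Ck_on k U f -> Ck_on k U (fun a => (f a)^-1).
Proof.
move=> oU f0; elim: k => [|k IH].
  by move=> cf a Ua; exact: cvgV (f0 a Ua) (cf a Ua).
move=> Cf; have [f1 f2] := Cf; have Ci := IH (Ck_pred Cf).
split=> [a Ua|v]; first by apply: differentiableV; [exact: f1|exact: f0].
have H : Ck_on k U (fun a => (-1 : R) *: (((f a)^-1 *: (f a)^-1) *: ('D_v f a : R))).
  apply: (Ck_scale oU (Ck_cst k U (-1 : R))).
  by apply: (Ck_scale oU (Ck_scale oU Ci Ci)); exact: f2.
apply: Ck_eq oU _ H => a Ua.
rewrite deriveV; [|exact: f0|by apply: diff_derivable; exact: f1].
by rewrite /GRing.scale /= expr2 invfM mulN1r mulNr.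
Qed.

Lemma Cinfty_diff n V (U : set 'rV[R]_n) (f : 'rV[R]_n -> V) a :
  Cinfty_on U f -> U a -> differentiable f a.
Proof. by move=> /(_ 1%N)[h _]; exact: h. Qed.

Lemma Cinfty_derive n V (U : set 'rV[R]_n) (f : 'rV[R]_n -> V) u :
  Cinfty_on U f -> Cinfty_on U ('D_u f : _ -> V).
Proof. by move=> Cf k; have [_ h] := Cf k.+1; exact: h. Qed.

End Ck.

(** * Mean values along segments and symmetry of second derivatives *)

Section Schwarz.
Context {R : realType}.
Implicit Types V W : normedModType R.

Lemma differentiable_id V (a : V) : differentiable (fun x : V => x) a.
Proof. exact: (@ex_diff _ _ _ _ _ _ _ (is_diff_id a)). Qed.

Lemma differentiable_const V W (c : W) (a : V) : differentiable (fun _ : V => c) a.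
Proof. exact: (@differentiable_cst _ _ _ c a). Qed.

Lemma derive_scalev V W (f : V -> W) a k v : differentiable f a ->
  'D_(k *: v) f a = k *: 'D_v f a.
Proof. by move=> df; rewrite !(deriveE _ df) linearZ. Qed.

Lemma is_diff_line V (a h : V) (t : R) :
  is_diff t (fun s : R => a + s *: h) (fun s => s *: h).
Proof.
have H := is_diffD (is_diff_cst a t) (is_diff_scalel t h).
by rewrite add0r in H.
Qed.

(** The difference quotient of the restriction of f to a line is that of f itself. Derivability thus
    passes between f and its restriction in both directions without a chain rule, which would
    require a differential. *)
Lemma growth_line V W (f : V -> W) (a h : V) (t : R) :
  (fun k : R => k^-1 *: ((f (a + (k *: 1 + t) *: h)) - f (a + t *: h))) =
  (fun k : R => k^-1 *: (f (k *: h + (a + t *: h)) - f (a + t *: h))).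
Proof.
apply/funext => k; have -> : k *: (1 : R) = k by exact: mulr1.
by rewrite scalerDl addrCA.
Qed.

Lemma derivable_line V W (f : V -> W) (a h : V) (t : R) :
  derivable f (a + t *: h) h -> derivable (fun s : R => f (a + s *: h)) t 1.
Proof. by rewrite /derivable /= growth_line. Qed.

Lemma line_derivable V W (f : V -> W) (a h : V) (t : R) :
  derivable (fun s : R => f (a + s *: h)) t 1 -> derivable f (a + t *: h) h.
Proof. by rewrite /derivable /= growth_line. Qed.

Lemma derive_line V W (f : V -> W) (a h : V) (t : R) :
  'D_1 (fun s : R => f (a + s *: h)) t = 'D_h f (a + t *: h).
Proof. by rewrite /derive /= growth_line. Qed.

Lemma is_derive_line V W (f : V -> W) (a h : V) (t : R) :
  differentiable f (a + t *: h) ->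
  is_derive t (1 : R) (fun s : R => f (a + s *: h)) ('D_h f (a + t *: h)).
Proof.
move=> df; rewrite -derive_line; apply: derivableP; apply: derivable_line.
exact: diff_derivable.
Qed.

(** Derivability in the single direction h is all that is known of an integral primitive before its
    differential is found. *)
Lemma derivable_MVT_line V (f : V -> R) (a h : V) :
  (forall t : R, 0 <= t <= 1 -> derivable f (a + t *: h) h) ->
  exists2 c : R, 0 <= c <= 1 & f (a + h) - f a = 'D_h f (a + c *: h).
Proof.
move=> df; pose g (s : R) := f (a + s *: h).
have [|||c] := @MVT_segment _ g (fun t => 'D_h f (a + t *: h)) 0 1.
- exact: ler01.
- move=> t /[!in_itv]/= /andP[/ltW t0 /ltW t1]; rewrite -derive_line.
  by apply: derivableP; apply: derivable_line; apply: df; rewrite t0.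
- apply: derivable_within_continuous => t /[!in_itv]/= t01.
  exact/derivable_line/df.
rewrite in_itv/= => c01; rewrite /g scale1r scale0r addr0 subr0 mulr1 => ->.
by exists c.
Qed.

Lemma MVT_line V (f : V -> R) (a h : V) :
  (forall t : R, 0 <= t <= 1 -> differentiable f (a + t *: h)) ->
  exists2 c : R, 0 <= c <= 1 & f (a + h) - f a = 'D_h f (a + c *: h).
Proof. by move=> df; apply: derivable_MVT_line => t /df/diff_derivable. Qed.

Lemma open_nbhs_norm V (U : set V) a : open U -> U a ->
  exists2 d : R, 0 < d & forall b, `|b - a| < d -> U b.
Proof.
move=> oU Ua; have /nbhs_ballP[d /= d0 h] := open_nbhs_nbhs (conj oU Ua).
by exists d => // b ba; apply: h; rewrite -ball_normE /= distrC.
Qed.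

(* The left-hand side is symmetric in u and v. *)
Lemma mixed_difference V (U : set V) (F : V -> R) a u v (h : R) :
  (forall b, U b -> differentiable F b) ->
  (forall b, U b -> differentiable ('D_u F : _ -> R) b) ->
  (forall s t : R, 0 <= s <= 1 -> 0 <= t <= 1 ->
     U (a + s *: (h *: u) + t *: (h *: v))) ->
  exists s t : R, [/\ 0 <= s <= 1, 0 <= t <= 1 &
    F (a + h *: u + h *: v) - F (a + h *: u) - (F (a + h *: v) - F a)
    = h * (h * 'D_v ('D_u F) (a + s *: (h *: u) + t *: (h *: v)))].
Proof.
move=> dF dD stU; set w := h *: v.
have sh b : is_diff b (fun x => x + w) id.
  by have H := is_diffD (is_diff_id b) (is_diff_cst w b); rewrite addr0 in H.
(* The mixed difference is the increment of G along [h *: u]. The mean value theorem for G, then for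
   ['D_u F] along w, produces the two factors h. *)
pose G b := F (b + w) - F b.
have dG b : U b -> U (b + w) -> differentiable G b /\ 'D_u G b = 'D_u F (b + w) - 'D_u F b.
  move=> Ub Ubv; have [d1 E1] := sh b.
  have dFv : differentiable (F \o (fun x => x + w)) b.
    by apply: differentiable_comp => //; exact: dF.
  split; first by apply: (differentiableB dFv); exact: dF.
  have -> : G = (F \o (fun x => x + w)) - F by [].
  rewrite deriveB; [|exact: diff_derivable|by apply: diff_derivable; exact: dF].
  by rewrite (derive_comp _ d1 (dF _ Ubv)) (deriveE _ d1) E1.
have U0 (s : R) : 0 <= s <= 1 -> U (a + s *: (h *: u)) /\ U (a + s *: (h *: u) + w).
  move=> s01; split.
    by have := stU s 0 s01; rewrite scale0r addr0; apply; rewrite lexx ler01.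
  by have := stU s 1 s01; rewrite scale1r; apply; rewrite lexx ler01.
have [|s s01] := @MVT_line _ G a (h *: u).
  by move=> s /U0[h1 h2]; have [] := dG _ h1 h2.
have [h1 h2] := U0 _ s01; have [dGs E] := dG _ h1 h2.
rewrite (derive_scalev _ _ dGs) {}E.
have [|t t01] := @MVT_line _ ('D_u F) (a + s *: (h *: u)) w.
  by move=> t t01; apply: dD; exact: stU.
rewrite (derive_scalev _ _ (dD _ (stU _ _ s01 t01))) => -> E.
by exists s, t.
Qed.

Lemma near_common V (U : set V) (f g : V -> R) a (e : R) :
  open U -> U a -> {for a, continuous f} -> {for a, continuous g} -> 0 < e ->
  exists2 d : R, 0 < d & forall b, ball a d b ->
    [/\ U b, `|f a - f b| < e & `|g a - g b| < e].
Proof.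
move=> oU Ua cf cg e0.
have /cvgrPdist_lt/(_ _ e0) n1 := cf; have /cvgrPdist_lt/(_ _ e0) n2 := cg.
have n0 : \near a, U a by exact: open_nbhs_nbhs.
have n3 : nbhs a (U `&` ([set b | `|f a - f b| < e] `&` [set b | `|g a - g b| < e])).
  exact: filterI n0 (filterI n1 n2).
move/nbhs_ballP: n3 => [d /= d0 H].
by exists d => // b /H[? []].
Qed.

(** The same mixed difference, divided by h^2, is a value near a of either second derivative;
    continuity of both then brings their values at a within any e of each other. *)
Lemma Schwarz n (U : set 'rV[R]_n) (F : 'rV[R]_n -> R) a u v :
  open U -> U a -> Ck_on 2 U F -> 'D_u ('D_v F) a = 'D_v ('D_u F) a.
Proof.
move=> oU Ua [dF CD].
have [dDu Cu] := CD u; have [dDv Cv] := CD v.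
apply/eqP; rewrite -subr_eq0 -normr_le0; apply/ler_addgt0Pl => e e0; rewrite addr0.
have [c1 c2] := (Cu v a Ua, Cv u a Ua).
have e2 : 0 < e / 2 by rewrite divr_gt0.
have [d d0 H] := near_common oU Ua c1 c2 e2.
(* With this h the parallelogram spanned by h u and h v lies in the ball of radius d. The added 1
   covers u = v = 0. *)
have [h h0 hE] : exists2 h : R, 0 < h & h * (`|u| + `|v|) < d.
  have k0 : 0 < `|u| + `|v| + 1 by rewrite ltr_wpDl// addr_ge0.
  exists (d / (`|u| + `|v| + 1)); first by rewrite divr_gt0.
  by rewrite mulrAC ltr_pdivrMr// ltr_pM2l// ltrDl.
have Hb (u1 v1 : 'rV[R]_n) (s t : R) : `|u1| + `|v1| = `|u| + `|v| ->
    0 <= s <= 1 -> 0 <= t <= 1 -> ball a d (a + s *: (h *: u1) + t *: (h *: v1)).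
  move=> uv /andP[s0 s1] /andP[t0 t1]; rewrite -ball_normE /= -addrA opprD addNKr normrN.
  apply: (@le_lt_trans _ _ (h * (`|u| + `|v|))).
    rewrite (le_trans (ler_normD _ _))// !normrZ (ger0_norm s0) (ger0_norm t0) (gtr0_norm h0).
    by rewrite -uv mulrDr; apply: lerD; apply: ler_piMl => //; rewrite mulr_ge0// ltW.
  exact: hE.
have [|s [t [s01 t01 E1]]] := @mixed_difference _ U F a u v h dF dDu.
  by move=> s t s01 t01; have [] := H _ (Hb u v s t erefl s01 t01).
have [|s' [t' [s01' t01' E2]]] := @mixed_difference _ U F a v u h dF dDv.
  by move=> s' t' s01' t01'; have [] := H _ (Hb v u s' t' (addrC _ _) s01' t01').
have [_ H1 _] := H _ (Hb u v s t erefl s01 t01).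
have [_ _ H2] := H _ (Hb v u s' t' (addrC _ _) s01' t01').
move: E1 E2 H1 H2; rewrite (addrAC a (h *: u)).
move: (F (a + h *: v + h *: u)) (F (a + h *: u)) (F (a + h *: v)) (F a) => w1 w2 w3 w4.
move: ('D_v ('D_u F) (a + s *: _ + _)) ('D_u ('D_v F) (a + s' *: _ + _)) => X Y.
move: ('D_v ('D_u F) a) ('D_u ('D_v F) a) => x y.
move=> E1 E2 H1 H2; have E : X = Y.
  by apply: (mulfI (lt0r_neq0 h0)); apply: (mulfI (lt0r_neq0 h0)); rewrite -E1 -E2; ring.
rewrite {}E in H1; rewrite -(subrKA Y) (le_trans (ler_normD _ _))// (splitr e).
by rewrite lerD// ltW// distrC.
Qed.

Lemma Schwarz_rV n m (U : set 'rV[R]_n) (F : 'rV[R]_n -> 'rV[R]_m) a u v :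
  open U -> U a -> Ck_on 2 U F -> 'D_u ('D_v F) a = 'D_v ('D_u F) a.
Proof.
move=> oU Ua CF; apply/rowP => i; have [dF CD] := CF.
have dD w : differentiable ('D_w F) a by have [d _] := CD w; exact: d.
have E w1 w2 : 'D_w1 ('D_w2 F) a 0 i = 'D_w1 ('D_w2 (fun x => F x 0 i : R)) a.
  apply: etrans (esym (derive_coord w1 i (dD w2))) _.
  apply: near_eq_derive; apply: open_near_eq oU Ua _ => b Ub.
  by apply: esym; apply: derive_coord; exact: dF.
apply: etrans (E u v) (etrans _ (esym (E v u))).
by apply: (Schwarz u v oU Ua); exact: (@Ck_coord _ n m 2 U F i oU (conj dF CD)).
Qed.

(** Expanding [Y b] over the standard basis reduces this to the product rule: one term
    differentiates F twice with the direction frozen at [Y a], the other differentiates the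
    direction. *)
Lemma derive_along_field n m (F : 'rV[R]_n -> 'rV[R]_m) (Y : 'rV[R]_n -> 'rV[R]_n) U a v :
  open U -> U a -> Ck_on 2 U F -> differentiable Y a ->
  'D_v (fun b => 'D_(Y b) F b) a = 'D_v ('D_(Y a) F) a + 'D_('D_v Y a) F a.
Proof.
move=> oU Ua [dF CD] dY.
have dD w : differentiable ('D_w F) a by have [d _] := CD w; exact: d.
have dYi i : differentiable (fun b => Y b 0 i : R) a.
  apply: (@differentiable_comp _ _ _ _ Y (fun y => y 0 i) a dY).
  exact: differentiable_coord.
have dt i : differentiable (fun b => Y b 0 i *: 'D_(delta_mx 0 i) F b) a.
  exact: differentiable_scale.
transitivity ('D_v (\sum_i (fun b => Y b 0 i *: 'D_(delta_mx 0 i) F b)) a).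
  apply: near_eq_derive; apply: open_near_eq oU Ua _ => b Ub.
  by rewrite fct_sumE; apply: derive_sum_delta; exact: dF.
rewrite derive_sum; last by move=> i; exact: diff_derivable.
have -> : 'D_v ('D_(Y a) F) a = 'D_v (\sum_i (fun b => Y a 0 i *: 'D_(delta_mx 0 i) F b)) a.
  apply: near_eq_derive; apply: open_near_eq oU Ua _ => b Ub.
  by rewrite fct_sumE; apply: derive_sum_delta; exact: dF.
rewrite derive_sum; last first.
  by move=> i; apply: diff_derivable; exact: differentiable_scale.
rewrite (derive_sum_delta _ (dF a Ua)) -big_split/=; apply: eq_bigr => i _.
have dc : differentiable (fun _ : 'rV[R]_n => Y a 0 i : R) a by exact: differentiable_const.
rewrite (derive_scale v (dYi i) (dD _)) (derive_scale v dc (dD _)).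
by rewrite (derive_coord v i dY) [X in _ = _ + X *: _ + _](@derive_cst _ _ R) scale0r addr0.
Qed.

End Schwarz.

(** * Differentiability from continuous directional derivatives *)

Section Poincare.
Context {R : realType}.
Implicit Types V W : normedModType R.

Lemma coord_le_norm n (u : 'rV[R]_n) i : `|u 0 i| <= `|u|.
Proof.
rewrite [leRHS]/Num.Def.normr/= mx_normrE.
by apply: le_trans (le_bigmax _ _ (0, i)).
Qed.

Lemma continuous_family (I : finType) V (W : I -> V -> R) a (e : R) :
  (forall i, {for a, continuous (W i)}) -> 0 < e ->
  exists2 d : R, 0 < d & forall i b, `|b - a| < d -> `|W i b - W i a| < e.
Proof.
move=> cW e0; have : \forall b \near a, forall i, `|W i a - W i b| < e.
  by apply: filter_forall => i; have /cvgrPdist_lt/(_ _ e0) := cW i.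
move=> /nbhs_ballP[d /= d0 H]; exists d => // i b ba; rewrite distrC.
by apply: H; rewrite -ball_normE /= distrC.
Qed.

Lemma locally_bounded (I : finType) V (W : I -> V -> R) a :
  (forall i, {for a, continuous (W i)}) ->
  exists K r : R, [/\ 0 <= K, 0 < r & forall i b, `|b - a| < r -> `|W i b| <= K].
Proof.
move=> cW; pose K : R := \sum_i (`|W i a| + 1).
have [r r0 H] := continuous_family cW ltr01; exists K, r; split=> //.
  by apply: sumr_ge0 => i _; rewrite addr_ge0.
move=> i b ba; apply: (@le_trans _ _ (`|W i a| + 1)).
  rewrite -[W i b](subrK (W i a)) addrC (le_trans (ler_normD _ _))// lerD2l ltW//.
  exact: H.
rewrite /K (bigD1 i)//= lerDl; apply: sumr_ge0 => j _; by rewrite addr_ge0.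
Qed.

(** The mean value theorem on the segment from a to a + h gives the increment as the sum of h_i W_i
    at an intermediate point, and continuity of the W_i at a moves that point to a. *)
Lemma differentiable_partials n (f : 'rV[R]_n -> R) (W : 'I_n -> 'rV[R]_n -> R) a (r : R) :
  0 < r ->
  (forall b u, `|b - a| < r -> derivable f b u /\ 'D_u f b = \sum_i u 0 i * W i b) ->
  (forall i, {for a, continuous (W i)}) ->
  differentiable f a.
Proof.
move=> r0 df cW; pose L (u : 'rV[R]_n) := \sum_i u 0 i * W i a.
have Ll : linear L.
  move=> k u v; rewrite /L /GRing.scale/= mulr_sumr -big_split/=; apply: eq_bigr => i _.
  by rewrite !mxE mulrDl mulrA.
pose LM := GRing.isLinear.Build _ _ _ _ _ Ll.
pose LL : {linear 'rV[R]_n -> R} := HB.pack L LM.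
suff H : is_diff a f LL by exact: ex_diff.
apply: is_diff_eps; first exact: continuous_linear_rV.
(* The error e is shared among the n coefficients; the extra 1 keeps the divisor positive when n =
   0. *)
move=> e e0; have m0 : 0 < n%:R + 1 :> R by rewrite ltr_wpDl.
have [d d0 Hd] := continuous_family cW (divr_gt0 e0 m0).
have : \forall h \near (0 : 'rV[R]_n), `|h| < Num.min r d.
  by apply: nbhs0_lt; rewrite lt_min r0 d0.
apply: filterS => h; rewrite lt_min => /andP[hr hd].
have nb (c : R) : 0 <= c <= 1 -> `|a + c *: h - a| <= `|h|.
  by move=> /andP[c0 c1]; rewrite addrAC subrr add0r normrZ ger0_norm// ler_piMl.
have [|c c01 E] := @derivable_MVT_line _ _ f a h.
  by move=> t t01; have [] := df (a + t *: h) h (le_lt_trans (nb t t01) hr).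
rewrite (addrC h) E; have [_ ->] := df (a + c *: h) h (le_lt_trans (nb c c01) hr).
rewrite /= /L -sumrB (le_trans (ler_norm_sum _ _ _))//.
apply: (@le_trans _ _ (\sum_(i < n) (`|h| * (e / (n%:R + 1))))).
  apply: ler_sum => i _; rewrite -mulrBr normrM ler_pM ?coord_le_norm// ltW//.
  by apply: Hd; rewrite (le_lt_trans (nb c c01)).
rewrite sumr_const card_ord -[leLHS]mulr_natr [leRHS]mulrC -[leLHS]mulrA ler_wpM2l//.
by rewrite mulrAC ler_pdivrMr// ler_pM2l// lerDl ler01.
Qed.

End Poincare.

(** * Closed forms are locally exact *)

Lemma continuous_sum_at (R : realType) (V : normedModType R) (I : Type) (r : seq I)
  (f : I -> V -> R) a : (forall i, {for a, continuous (f i)}) ->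
  {for a, continuous (fun x => \sum_(i <- r) f i x)}.
Proof.
move=> cf; rewrite /prop_for /continuous_at; elim: r => [|i r IH].
  by rewrite big_nil; under eq_fun do rewrite big_nil; exact: (@cvg_cst _ _ _ (nbhs a)).
rewrite big_cons; under eq_fun do rewrite big_cons.
by apply: cvgD IH; exact: cf.
Qed.

Section Poincare.
Context {R : realType} (n : nat) (W : 'I_n -> 'rV[R]_n -> R) (a0 : 'rV[R]_n) (r : R).
Hypothesis r0 : 0 < r.
Hypothesis dW : forall i b, `|b - a0| < r -> differentiable (W i) b.
Hypothesis cDW : forall i u b, `|b - a0| < r -> {for b, continuous ('D_u (W i) : _ -> R)}.
Hypothesis closed : forall i j b, `|b - a0| < r ->
  'D_(delta_mx 0 i) (W j) b = 'D_(delta_mx 0 j) (W i) b.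

(* The primitive is the integral of [Phi t (a - a0)] over t in [0, 1]. *)
Let Phi (t : R) (b : 'rV[R]_n) : R := \sum_i b 0 i *: W i (a0 + t *: b).

Let ray (t : R) (b : 'rV[R]_n) : 0 <= t <= 1 -> `|b| < r -> `|a0 + t *: b - a0| < r.
Proof.
move=> /andP[t0 t1] br; rewrite addrAC subrr add0r normrZ ger0_norm//.
by apply: le_lt_trans br; rewrite ler_piMl.
Qed.

Lemma is_diff_ray (t : R) (b : 'rV[R]_n) :
  is_diff b (fun b : 'rV[R]_n => a0 + t *: b) (fun b : 'rV[R]_n => t *: b).
Proof.
have H := is_diffD (is_diff_cst a0 b) (is_diff_scaler t b).
by rewrite add0r in H.
Qed.

Lemma derive_ray (t : R) (b v : 'rV[R]_n) i : 0 <= t <= 1 -> `|b| < r ->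
  differentiable (fun b : 'rV[R]_n => W i (a0 + t *: b)) b /\
  'D_v (fun b : 'rV[R]_n => W i (a0 + t *: b)) b = t * 'D_v (W i) (a0 + t *: b).
Proof.
move=> t01 br; have dWi := dW i (ray t01 br).
have [d1 E1] := is_diff_ray t b; split; first exact: (differentiable_comp d1 dWi).
refine (etrans (derive_comp v d1 dWi) _).
by rewrite (deriveE _ d1) E1 (derive_scalev _ _ dWi).
Qed.

Lemma derive_coord_id (b v : 'rV[R]_n) i : 'D_v (fun b : 'rV[R]_n => b 0 i : R) b = v 0 i.
Proof. by rewrite (derive_coord v i (differentiable_id b)) derive_id. Qed.

Lemma derive_Phi (t : R) (b v : 'rV[R]_n) : 0 <= t <= 1 -> `|b| < r ->
  derivable (Phi t) b v /\
  'D_v (Phi t) b = \sum_i (b 0 i * (t * 'D_v (W i) (a0 + t *: b)) + v 0 i * W i (a0 + t *: b)).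
Proof.
move=> t01 br; have E : Phi t = \sum_i (fun b : 'rV[R]_n => b 0 i *: W i (a0 + t *: b)).
  by apply/funext => x; rewrite fct_sumE.
have dc i : differentiable (fun b : 'rV[R]_n => b 0 i : R) b by exact: differentiable_coord.
have dR i : differentiable (fun b : 'rV[R]_n => W i (a0 + t *: b)) b.
  by have [] := derive_ray b i t01 br.
have D i : derivable (fun b : 'rV[R]_n => b 0 i *: W i (a0 + t *: b)) b v.
  by apply: diff_derivable; exact: differentiable_scale.
rewrite E; split; first exact: derivable_sum.
rewrite derive_sum//; apply: eq_bigr => i _.
rewrite (derive_scale v (dc i) (dR i)) derive_coord_id.
by have [_ ->] := derive_ray v i t01 br.
Qed.

(** The function t W(a0 + t b)(v) of t takes the values 0 at 0 and W(a0 + b)(v) at 1; integrating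
    its derivative over [0, 1] evaluates the derivative of the primitive. *)
Lemma derive_Psi (t : R) (b v : 'rV[R]_n) : 0 <= t <= 1 -> `|b| < r ->
  is_derive t (1 : R) (fun t : R => \sum_i v 0 i * (t * W i (a0 + t *: b)))
   (\sum_i v 0 i * (t * 'D_b (W i) (a0 + t *: b) + W i (a0 + t *: b))).
Proof.
move=> t01 br.
have E : (fun t : R => \sum_i v 0 i * (t * W i (a0 + t *: b))) =
   \sum_i (fun t : R => v 0 i * (t * W i (a0 + t *: b))).
  by apply/funext => x; rewrite fct_sumE.
rewrite E; apply: is_derive_sum => i.
have H : is_derive t (1 : R) (fun t : R => W i (a0 + t *: b)) ('D_b (W i) (a0 + t *: b)).
  exact/is_derive_line/dW/ray.
have H2 := @is_deriveZ _ _ _ _ (v 0 i) t 1 _ (is_deriveM (is_derive_id t 1) H).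
have E2 : 'D_b (W i) (a0 + t *: b) * t + W i (a0 + t *: b) =
   t *: 'D_b (W i) (a0 + t *: b) + W i (a0 + t *: b) *: 1.
  by rewrite /GRing.scale/= mulr1 mulrC.
by rewrite [t * _]mulrC E2; exact: H2.
Qed.

(* Closedness turns the derivative of the integrand in the direction v into the
   t-derivative of t W(a0 + t b)(v). *)
Lemma closed_swap (t : R) (b v : 'rV[R]_n) : 0 <= t <= 1 -> `|b| < r ->
  \sum_i (b 0 i * (t * 'D_v (W i) (a0 + t *: b)) + v 0 i * W i (a0 + t *: b)) =
  \sum_i v 0 i * (t * 'D_b (W i) (a0 + t *: b) + W i (a0 + t *: b)).
Proof.
move=> t01 br; have P := ray t01 br.
under [RHS]eq_bigr do rewrite mulrDr.
rewrite !big_split/=; refine (congr1 (fun z => z + \sum_i v 0 i * W i (a0 + t *: b)) _).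
under eq_bigr do rewrite (derive_sum_delta v (dW _ P)) mulr_sumr mulr_sumr.
under [RHS]eq_bigr do rewrite (derive_sum_delta b (dW _ P)) mulr_sumr mulr_sumr.
rewrite exchange_big/=; apply: eq_bigr => i _; apply: eq_bigr => j _.
by rewrite (closed i j P) /GRing.scale/= mulrCA [RHS]mulrCA; congr (_ * _); rewrite mulrCA.
Qed.

(** Provides the constant dominating function required to differentiate under the integral. *)
Lemma derive_Phi_bound (r1 K : R) (v : 'rV[R]_n) : r1 <= r -> 0 <= r1 -> 0 <= K ->
  (forall i (b : 'rV[R]_n), `|b - a0| < r1 -> `|W i b| <= K) ->
  (forall i j (b : 'rV[R]_n), `|b - a0| < r1 -> `|'D_(delta_mx 0 j) (W i) b| <= K) ->
  exists2 G : R, 0 <= G & forall (t : R) (b : 'rV[R]_n), 0 <= t <= 1 -> `|b| < r1 ->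
    `|'D_v (Phi t) b| <= G.
Proof.
move=> r1r r10 K0 bW bD.
exists (\sum_i (r1 * (\sum_j `|v 0 j| * K) + `|v 0 i| * K)).
  by apply: sumr_ge0 => i _; rewrite addr_ge0// mulr_ge0// sumr_ge0// => j _; rewrite mulr_ge0.
move=> t b t01 br; have br' := lt_le_trans br r1r.
have [_ ->] := derive_Phi v t01 br'.
have P : `|a0 + t *: b - a0| < r1.
  move: t01 => /andP[t0 t1]; rewrite addrAC subrr add0r normrZ ger0_norm//.
  by apply: le_lt_trans br; rewrite ler_piMl.
have P' := lt_le_trans P r1r.
rewrite (le_trans (ler_norm_sum _ _ _))//; apply: ler_sum => i _.
rewrite (le_trans (ler_normD _ _))// lerD//; last first.
  by rewrite normrM ler_wpM2l// bW.
rewrite normrM; apply: ler_pM => //.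
  exact: le_trans (coord_le_norm _ _) (ltW br).
move: t01 => /andP[t0 t1]; rewrite normrM ger0_norm//.
apply: (@le_trans _ _ `|'D_v (W i) (a0 + t *: b)|); first by rewrite ler_piMl.
rewrite (derive_sum_delta v (dW i P')) (le_trans (ler_norm_sum _ _ _))//.
by apply: ler_sum => j _; rewrite normrM ler_wpM2l// bD.
Qed.

Let mu := @lebesgue_measure R.

Let f (a : 'rV[R]_n) : R := \int[mu]_(t in `[0, 1]) Phi t (a - a0).

Lemma Phi_integrable (b : 'rV[R]_n) : `|b| < r -> mu.-integrable `[0, 1] (EFin \o (Phi ^~ b)).
Proof.
move=> br; apply: continuous_compact_integrable; first exact: segment_compact.
apply: derivable_within_continuous => t /[!in_itv]/= t01.
have E : Phi ^~ b = \sum_i (fun t : R => b 0 i * W i (a0 + t *: b)).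
  by apply/funext => x; rewrite fct_sumE.
rewrite E; apply: derivable_sum => i; apply: derivableM; first exact: derivable_cst.
by have [] := is_derive_line (dW i (ray t01 br)).
Qed.

Lemma integral_Psi (b v : 'rV[R]_n) : `|b| < r ->
  \int[mu]_(t in `[0, 1]) (\sum_i v 0 i * (t * 'D_b (W i) (a0 + t *: b) + W i (a0 + t *: b)))
  = \sum_i v 0 i * W i (a0 + b).
Proof.
move=> br; pose Psi (t : R) := \sum_i v 0 i * (t * W i (a0 + t *: b)).
have dPsi (t : R) : 0 <= t <= 1 -> derivable Psi t 1.
  by move=> t01; have [] := derive_Psi v t01 br.
have cPsi (t : R) : 0 <= t <= 1 -> {for t, continuous Psi}.
  by move=> t01; exact/differentiable_continuous/derivable1_diffP/dPsi.
rewrite /Rintegral (@continuous_FTC2 _ _ Psi)//.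
- rewrite -EFinB /= /Psi; rewrite -sumrB; apply: eq_bigr => i _.
  by rewrite mul0r mulr0 subr0 mul1r scale1r.
- apply: continuous_in_subspaceT => t; rewrite inE/= in_itv/= => t01.
  have cl : {for t, continuous (fun s : R => a0 + s *: b)}.
    by apply: differentiable_continuous; have [] := is_diff_line a0 b t.
  have P := ray t01 br.
  apply: continuous_sum_at => i.
  have c1 : {for t, continuous ('D_b (W i) \o (fun s : R => a0 + s *: b))}.
    exact: (continuous_comp cl (@cDW i b _ P)).
  have c2 : {for t, continuous (W i \o (fun s : R => a0 + s *: b))}.
    exact: (continuous_comp cl (differentiable_continuous (dW i P))).
  have cv : {for t, continuous (fun _ : R => v 0 i)} by exact: (@cvg_cst _ _ _ (nbhs t)).
  have ci : {for t, continuous (fun s : R => s)} by exact: (@cvg_id _ (nbhs t)).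
  exact: (continuousM cv (continuousD (continuousM ci c1) c2)).
- split.
  + by move=> t; rewrite in_itv/= => /andP[t0 t1]; apply: dPsi; rewrite !ltW.
  + by apply: cvg_at_right_filter; apply: cPsi; rewrite lexx ler01.
  + by apply: cvg_at_left_filter; apply: cPsi; rewrite lexx ler01.
- move=> t; rewrite in_itv/= => /andP[t0 t1]; rewrite derive1E.
  by have [|_ ->] := @derive_Psi t b v _ br; rewrite ?(ltW t0) ?ltW.
Qed.

(** On the line a + s v the primitive is an integral depending on the parameter s. Its derivative at
    s = 0 is taken under the integral sign, and [closed_swap] makes the integrand an exact
    t-derivative. *)
Lemma derive_primitive (r1 K : R) (a v : 'rV[R]_n) : 0 < r1 -> r1 <= r -> 0 <= K ->
  (forall i (b : 'rV[R]_n), `|b - a0| < r1 -> `|W i b| <= K) ->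
  (forall i j (b : 'rV[R]_n), `|b - a0| < r1 -> `|'D_(delta_mx 0 j) (W i) b| <= K) ->
  `|a - a0| < r1 -> derivable f a v /\ 'D_v f a = \sum_i v 0 i * W i a.
Proof.
move=> r10 r1r K0 bW bD ar; set b := a - a0.
have [G G0 HG] := derive_Phi_bound v r1r (ltW r10) K0 bW bD.
(* For |s| < e the point b + s v stays in the ball of radius r1; the added 1 covers v = 0. *)
pose e := (r1 - `|b|) / (`|v| + 1).
have v1 : 0 < `|v| + 1 by rewrite ltr_wpDl.
have e0 : 0 < e by rewrite divr_gt0// subr_gt0.
have br (s : R) : `]- e, e[%classic s -> `|b + s *: v| < r1.
  rewrite /= in_itv/= -ltr_norml => se.
  rewrite (le_lt_trans (ler_normD _ _))// -ltrBrDl normrZ.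
  apply: (@le_lt_trans _ _ (`|s| * (`|v| + 1))); first by rewrite ler_wpM2l// lerDl.
  by rewrite -ltr_pdivlMr.
pose F (s t : R) := Phi t (b + s *: v).
have I0 : `]- e, e[%classic (0 : R) by rewrite /= in_itv/= oppr_lt0 e0.
have H1 s : `]- e, e[%classic s -> mu.-integrable `[0, 1] (EFin \o F s).
  by move=> /br h; apply: Phi_integrable; exact: lt_le_trans h r1r.
have dF (s t : R) : `]- e, e[%classic s -> `[0, 1]%classic t ->
   derivable (F ^~ t) s 1 /\ 'D_1 (F ^~ t) s = 'D_v (Phi t) (b + s *: v).
  rewrite [X in _ -> X -> _]/= in_itv/= => /br h t01; have h' := lt_le_trans h r1r.
  have [d1 _] := derive_Phi v t01 h'.
  by split; [exact: derivable_line|exact: derive_line].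
have H2 s t : `]- e, e[%classic s -> `[0, 1]%classic t -> derivable (F ^~ t) s 1.
  by move=> se t01; have [] := dF s t se t01.
have H3 : mu.-integrable `[0, 1] (EFin \o (fun=> G)).
  apply: continuous_compact_integrable; first exact: segment_compact.
  by apply: derivable_within_continuous => t _; exact: derivable_cst.
have H4 s t : `]- e, e[%classic s -> `[0, 1]%classic t -> `|partial1of2 F s t| <= G.
  move=> se t01; rewrite partial1of2E; have [_ ->] := dF s t se t01.
  by apply: HG; [|exact: br].
have D1 := @derivable_under_integral R _ _ mu F `[0, 1]%classic (measurable_itv _) 0 (- e) e
  I0 H1 H2 (fun=> G) (fun=> G0) H3 H4.
have D2 := @differentiation_under_integral R _ _ mu F `[0, 1]%classic (measurable_itv _) 0 (- e) e
  I0 H1 H2 (fun=> G) (fun=> G0) H3 H4.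
have fE : (fun s : R => \int[mu]_(t in `[0, 1]) F s t) = (fun s : R => f (a + s *: v)).
  apply/funext => s; rewrite /f /F; apply: eq_Rintegral => t _.
  by rewrite /b addrAC.
rewrite fE in D1 D2.
have := line_derivable D1; rewrite scale0r addr0 => df; split => //.
rewrite derive1E derive_line scale0r addr0 in D2; rewrite D2.
rewrite -[X in _ = \sum_i v 0 i * W i X](subrKC a0 a) -/b.
rewrite -(integral_Psi v (lt_le_trans ar r1r)); apply: eq_Rintegral => t.
rewrite inE/= => t01; rewrite partial1of2E; have [_ ->] := dF 0 t I0 t01.
move: t01; rewrite /= in_itv/= => t01; rewrite scale0r addr0.
have [_ ->] := derive_Phi v t01 (lt_le_trans ar r1r).
exact: (closed_swap v t01 (lt_le_trans ar r1r)).
Qed.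

(** The radius shrinks because the bounds on the W_i and their partial derivatives come from
    continuity at a0, hence hold only near a0. *)
Lemma Poincare : exists r1 : R, exists h : 'rV[R]_n -> R, [/\ 0 < r1, r1 <= r &
  forall a, `|a - a0| < r1 -> differentiable h a /\
    forall v, 'D_v h a = \sum_i v 0 i * W i a].
Proof.
have c0 : `|a0 - a0| < r by rewrite subrr normr0.
have [K1 [r1 [K10 r10 H1]]] := @locally_bounded _ _ _ W a0
  (fun i => differentiable_continuous (dW i c0)).
have [K2 [r2 [K20 r20 H2]]] := @locally_bounded _ ('I_n * 'I_n)%type _
  (fun ij => 'D_(delta_mx 0 ij.2) (W ij.1) : _ -> R) a0 (fun ij => @cDW ij.1 _ _ c0).
pose r3 := Num.min r (Num.min r1 r2).
have r30 : 0 < r3 by rewrite !lt_min r0 r10 r20.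
have r3r : r3 <= r by rewrite ge_min lexx.
have lt1 (y : R) : y < r3 -> y < r1 by rewrite !lt_min => /and3P[].
have lt2 (y : R) : y < r3 -> y < r2 by rewrite !lt_min => /and3P[].
pose K := Num.max K1 K2.
have K0 : 0 <= K by rewrite le_max K10.
have D a v : `|a - a0| < r3 -> derivable f a v /\ 'D_v f a = \sum_i v 0 i * W i a.
  apply: (derive_primitive v r30 r3r K0).
    by move=> i b /lt1 /(H1 i) h; rewrite le_max h.
  by move=> i j b /lt2 /(H2 (i, j)) h; rewrite le_max h orbT.
exists r3, f; split => // a ar; split; last by move=> v; have [] := D a v ar.
have r4 : 0 < r3 - `|a - a0| by rewrite subr_gt0.
(* The directional derivatives of the primitive have the continuous W_i as coefficients, which
   upgrades them to a differential. *)
apply: (differentiable_partials (W := W) r4) => [b u ba|i].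
  apply: D; rewrite -(subrKA a) (le_lt_trans (ler_normD _ _))//.
  by rewrite -ltrBrDr.
exact/differentiable_continuous/dW/(lt_le_trans ar).
Qed.

End Poincare.

(** * Implicit functions *)

Lemma ball_convex (R : realType) (V : normedModType R) (a0 a b : V) (r c : R) :
  0 <= c <= 1 -> `|a - a0| < r -> `|b - a0| < r -> `|a + c *: (b - a) - a0| < r.
Proof.
move=> /andP[c0 c1] ar br.
have -> : a + c *: (b - a) - a0 = (1 - c) *: (a - a0) + c *: (b - a0).
  rewrite scalerBl scale1r !scalerBr opprB.
  by rewrite -[RHS]addrA [X in _ = _ + X]addrC subrKA addrAC.
have [->|c0'] := eqVneq c 0; first by rewrite subr0 scale1r scale0r addr0.
rewrite (le_lt_trans (ler_normD _ _))// !normrZ (ger0_norm c0) ger0_norm ?subr_ge0//.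
have -> : r = (1 - c) * r + c * r by rewrite -mulrDl subrK mul1r.
apply: ler_ltD; first by rewrite ler_wpM2l ?subr_ge0// ltW.
by rewrite ltr_pM2l// lt_neqAle eq_sym c0' c0.
Qed.

Lemma open_norm_ball (R : realType) (V : normedModType R) (a : V) (r : R) :
  open [set b | `|b - a| < r].
Proof.
rewrite (_ : [set b | _] = ball a r); first exact: ball_open.
by apply/seteqP; split=> b; rewrite -ball_normE /= distrC.
Qed.

Lemma linear_solve (R : fieldType) (a b x : R) :
  a != 0 -> 0 = x * a + b -> x = - b * a^-1.
Proof. by move=> a0 /esym/eqP; rewrite addr_eq0 => /eqP <-; rewrite mulfK. Qed.

Lemma Ck_linear (R : realType) n (V : normedModType R) k (U : set 'rV[R]_n)
  (L : {linear 'rV[R]_n -> V}) : Ck_on k U L.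
Proof.
case: k => [|k]; first by move=> a _; exact: continuous_linear_rV.
have dL a : differentiable L a by apply: linear_differentiable; exact: continuous_linear_rV.
split=> [a _|v]; first exact: dL.
have -> : 'D_v L = cst (L v).
  by apply/funext => a; rewrite (deriveE _ (dL a)) diff_lin//; exact: continuous_linear_rV.
exact: Ck_cst.
Qed.

Section implicit.
Context {R : realType} (n m : nat) (f : 'rV[R]_n -> R) (a0 e : 'rV[R]_n)
  (K : 'M[R]_(m, n)) (r d c1 k delta : R) (F : 'rV[R]_m -> R).

Let U := [set b : 'rV[R]_n | `|b - a0| < r].
Let D := [set y : 'rV[R]_m | `|y| < delta].
(** The graph of F over the row space of K, in the direction e transverse to the level set. *)
Let phi (y : 'rV[R]_m) := a0 + y *m K + F y *: e.

Hypothesis Cf : Cinfty_on U f.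
Hypothesis d0 : 0 < d.
Hypothesis fe : forall b, U b -> d <= 'D_e f b.
Hypothesis c10 : 0 <= c1.
Hypothesis fK : forall b h, U b -> `|'D_(h *m K) f b| <= c1 * `|h|.
Hypothesis k0 : 0 <= k.
Hypothesis Kk : forall h : 'rV[R]_m, `|h *m K| <= k * `|h|.
Hypothesis phiU : forall y, D y -> U (phi y).
Hypothesis root : forall y, D y -> f (phi y) = f a0.

Let df b : U b -> differentiable f b.
Proof. exact: Cinfty_diff Cf. Qed.

Let fe0 b : U b -> 0 < 'D_e f b. Proof. by move=> /fe; exact: lt_le_trans. Qed.

(** Implicit differentiation: at [phi y] this is the i-th partial derivative of F. *)
Let Q (i : 'I_m) (b : 'rV[R]_n) : R := - 'D_(delta_mx 0 i *m K) f b * ('D_e f b)^-1.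

Let oU : open U. Proof. exact: open_norm_ball. Qed.
Let oD : open D.
Proof.
have -> : D = [set y : 'rV[R]_m | `|y - 0| < delta].
  by apply/seteqP; split=> y; rewrite /D/= subr0.
exact: open_norm_ball.
Qed.

(* The mean value theorem applied to f between phi y and phi y', where f takes the
   same value. F may be any choice of roots. *)
Lemma increment y y' : D y -> D y' -> exists b,
  [/\ U b, `|b - phi y| <= `|phi y' - phi y| &
   F y' - F y = - 'D_((y' - y) *m K) f b * ('D_e f b)^-1].
Proof.
move=> Dy Dy'; have Uy := phiU Dy; have Uy' := phiU Dy'.
have [|c c01 E] := @MVT_line _ _ f (phi y) (phi y' - phi y).
  by move=> t t01; apply: df; exact: ball_convex.
have Ub : U (phi y + c *: (phi y' - phi y)) by exact: ball_convex.
set b := phi y + c *: (phi y' - phi y) in E Ub.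
exists b; split=> //.
  rewrite /b addrAC subrr add0r normrZ; move: c01 => /andP[h0 h1].
  by rewrite ger0_norm// ler_piMl.
have dphi : phi y' - phi y = (F y' - F y) *: e + (y' - y) *m K.
  rewrite /phi mulmxBl scalerBl; move: (y' *m K) (y *m K) => u v.
  by apply/rowP => i; rewrite !mxE; ring.
move: E; rewrite subrKC !root// subrr dphi.
have -> := derive_linear (df Ub) (F y' - F y) e ((y' - y) *m K).
exact: linear_solve (lt0r_neq0 (fe0 Ub)).
Qed.

(** Bounds the numerator in [increment] by c1 and its denominator from below by d. Nothing is known
    yet about the regularity of F, and this is what makes [phi] continuous. *)
Lemma implicit_lipschitz y y' : D y -> D y' -> `|F y' - F y| <= c1 / d * `|y' - y|.
Proof.
move=> Dy Dy'; have [b [Ub _ ->]] := increment Dy Dy'.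
rewrite normrM normrN normfV mulrAC; apply: ler_pM => //; first exact: fK.
rewrite (gtr0_norm (fe0 Ub)) lef_pV2 ?posrE//; [exact: fe|exact: fe0].
Qed.

Lemma quotient_sum b (h : 'rV[R]_m) : U b ->
  - 'D_(h *m K) f b * ('D_e f b)^-1 = \sum_i h 0 i * Q i b.
Proof.
move=> Ub; have L : linear (fun h : 'rV[R]_m => 'D_(h *m K) f b).
  by move=> s u v; rewrite mulmxDl -scalemxAl (derive_linear (df Ub)).
rewrite {1}[h]row_sum_delta (linear_big _ _ L) -sumrN mulr_suml.
by apply: eq_bigr => i _; rewrite (linear_scale L) /Q /GRing.scale/= -mulrN mulrA.
Qed.

Lemma quotient_smooth i : Cinfty_on U (Q i).
Proof.
move=> j; have h1 : Ck_on j U (fun b => 'D_(delta_mx 0 i *m K) f b : R).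
  exact: Cinfty_derive Cf j.
have h2 : Ck_on j U (fun b => ('D_e f b)^-1 : R).
  apply: (Ck_inv oU); first by move=> b /fe0/lt0r_neq0.
  exact: Cinfty_derive Cf j.
have h3 := Ck_scale oU (Ck_cst j U (-1 : R)) (Ck_scale oU h1 h2).
apply: Ck_eq oU _ h3 => b Ub.
by rewrite /Q /GRing.scale/= mulN1r mulNr.
Qed.

(** The increment of F is a combination of the Q_i at an intermediate point b no further from
    [phi y] than [phi (h + y)] is. The Lipschitz bound makes that distance O(|h|), and continuity of
    the Q_i does the rest. *)
Lemma implicit_is_diff y : D y -> exists L : {linear 'rV[R]_m -> R},
  (forall h, L h = \sum_i h 0 i * Q i (phi y)) /\ is_diff y F L.
Proof.
move=> Dy; have Uy := phiU Dy; pose L (h : 'rV[R]_m) := \sum_i h 0 i * Q i (phi y).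
have Ll : linear L.
  move=> s u v; rewrite /L /GRing.scale/= mulr_sumr -big_split/=; apply: eq_bigr => i _.
  by move: (Q i (phi y)) => z; rewrite !mxE mulrDl mulrA.
pose LM := GRing.isLinear.Build _ _ _ _ _ Ll.
pose LL : {linear 'rV[R]_m -> R} := HB.pack L LM.
exists LL; split=> //; apply: is_diff_eps; first exact: continuous_linear_rV.
move=> eps eps0; have m0 : 0 < m%:R + 1 :> R by rewrite ltr_wpDl.
have cQ i : {for phi y, continuous (Q i)}.
  by apply: differentiable_continuous; exact: Cinfty_diff (quotient_smooth i) Uy.
have [s s0 Hs] := continuous_family cQ (divr_gt0 eps0 m0).
(* Bounds the displacement of [phi] by k2 |h|: k comes from K, c1 / d from the Lipschitz constant of
   F, and 1 is added for positivity. *)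
pose k2 := k + c1 / d * `|e| + 1.
have k20 : 0 < k2 by rewrite /k2 ltr_wpDl// addr_ge0// mulr_ge0// divr_ge0// ltW.
have n1 : \forall h \near (0 : 'rV[R]_m), `|h| < s / k2.
  by apply: nbhs0_lt; rewrite divr_gt0.
have n2 : \forall h \near (0 : 'rV[R]_m), D (h + y).
  have n0 : \forall z \near y, D z by exact: open_nbhs_nbhs.
  by move: n0; rewrite (near_shift 0) subr0.
apply: filterS2 n1 n2 => h h1 h2.
have [b [Ub bphi ->]] := increment Dy h2.
rewrite addrK quotient_sum//= /L -sumrB.
have lip := implicit_lipschitz Dy h2; rewrite addrK in lip.
have bs : `|b - phi y| < s.
  apply: le_lt_trans bphi _; move: h1; rewrite ltr_pdivlMr// => h1.
  apply: le_lt_trans _ h1.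
  have -> : phi (h + y) - phi y = h *m K + (F (h + y) - F y) *: e.
    rewrite /phi mulmxDl scalerBl; move: (h *m K) (y *m K) => u v.
    by apply/rowP => i; rewrite !mxE; ring.
  rewrite (le_trans (ler_normD _ _))// normrZ /k2 !mulrDr mulr1.
  rewrite -[leLHS]addr0 lerD// lerD//; first by rewrite mulrC Kk.
  by rewrite mulrCA mulrA mulrC -mulrA [leRHS]mulrA [leRHS]mulrC ler_wpM2l// mulrC.
rewrite (le_trans (ler_norm_sum _ _ _))//.
apply: (@le_trans _ _ (\sum_(i < m) (`|h| * (eps / (m%:R + 1))))).
  by apply: ler_sum => i _; rewrite -mulrBr normrM ler_pM ?coord_le_norm// ltW// Hs.
rewrite sumr_const card_ord -[leLHS]mulr_natr [leRHS]mulrC -[leLHS]mulrA ler_wpM2l//.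
by rewrite mulrAC ler_pdivrMr// ler_pM2l// lerDl ler01.
Qed.

(** A bootstrap: the derivatives of F are combinations of the smooth Q_i composed with [phi], which
    is as regular as F, so each order gives the next. *)
Lemma implicit_smooth : Cinfty_on D F.
Proof.
have dF y : D y -> differentiable F y.
  by move=> /implicit_is_diff[L [_ h]]; exact: ex_diff.
have DF y v : D y -> 'D_v F y = \sum_i v 0 i * Q i (phi y).
  move=> Dy; have [L [<- h]] := implicit_is_diff Dy.
  by rewrite (deriveE _ (dF _ Dy)) diff_val.
elim=> [|j IH]; first by move=> y Dy; exact: differentiable_continuous (dF y Dy).
split=> // v.
have Cphi : Ck_on j D phi.
  apply: (Ck_add oD); last by apply: (Ck_scale oD IH); exact: Ck_cst.
  apply: (Ck_add oD); first exact: Ck_cst.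
  exact: (Ck_linear _ _ (mulmxr K)).
have H i : Ck_on j D (fun y => v 0 i *: Q i (phi y)).
  apply: (Ck_scale oD); first exact: Ck_cst.
  exact: (Ck_comp oD oU phiU Cphi (quotient_smooth i j)).
apply: Ck_eq oD _ (Ck_sum (index_enum 'I_m) oD H) => y Dy.
by rewrite DF.
Qed.

End implicit.

(* Otherwise failed unifications of two derivatives unfold them down to limits. *)
#[local] Opaque derive.

Section implicit.
Context {R : realType} (n m : nat) (f : 'rV[R]_n -> R) (a0 e : 'rV[R]_n)
  (K : 'M[R]_(m, n)) (r d c1 k rho : R).

Let U := [set b : 'rV[R]_n | `|b - a0| < r].

Hypothesis r0 : 0 < r.
Hypothesis df : forall b, U b -> differentiable f b.
Hypothesis fe : forall b, U b -> d <= 'D_e f b.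
Hypothesis fK : forall b h, U b -> `|'D_(h *m K) f b| <= c1 * `|h|.
Hypothesis Kk : forall h : 'rV[R]_m, `|h *m K| <= k * `|h|.
Hypothesis rho0 : 0 < rho.
Hypothesis rhoe : rho * `|e| < r / 2.

Let U_plus (y : 'rV[R]_m) (u : R) : k * `|y| < r / 2 -> `|u| <= rho ->
  U (a0 + y *m K + u *: e).
Proof.
move=> yr ur; rewrite /U /= -(addrA a0) (addrC a0) addrK (le_lt_trans (ler_normD _ _))//.
rewrite (splitr r); apply: ltrD; first exact: le_lt_trans (Kk y) yr.
by rewrite normrZ (le_lt_trans _ rhoe)// ler_wpM2r.
Qed.

(** Since ['D_e f] is at least d, moving by rho or -rho along e raises or lowers f by at least rho
    d, whereas the displacement [y *m K] changes f by no more than that. The intermediate value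
    theorem on the segment gives the root. *)
Lemma implicit_root (y : 'rV[R]_m) : k * `|y| < r / 2 -> (c1 + 1) * `|y| < rho * d ->
  exists u : R, `|u| <= rho /\ f (a0 + y *m K + u *: e) = f a0.
Proof.
move=> yr yd; have rr : `|rho| <= rho by rewrite ger0_norm// ltW.
have U0 : U (a0 + y *m K).
  by have := @U_plus y 0 yr; rewrite scale0r addr0 normr0; apply; exact: ltW.
have Ua0 : U a0 by rewrite /U/= subrr normr0.
have bnd (u : R) : `|u| <= rho ->
    exists2 w, d <= w & f (a0 + y *m K + u *: e) - f (a0 + y *m K) = u * w.
  move=> ur; have Uu := U_plus yr ur.
  have Ut (t : R) : 0 <= t <= 1 -> U (a0 + y *m K + t *: (u *: e)).
    move=> /andP[t0 t1]; rewrite scalerA; apply: U_plus => //.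
    by rewrite normrM ger0_norm//; apply: le_trans ur; rewrite ler_piMl.
  have [|t t01 ->] := @MVT_line _ _ f (a0 + y *m K) (u *: e).
    by move=> t t01; apply: df; exact: Ut.
  exists ('D_e f (a0 + y *m K + t *: (u *: e))); first by apply: fe; exact: Ut.
  by rewrite derive_scalev//; apply: df; exact: Ut.
have low : `|f (a0 + y *m K) - f a0| <= rho * d.
  have Ut (t : R) : 0 <= t <= 1 -> U (a0 + t *: (y *m K)).
    move=> t01; have := ball_convex t01 Ua0 U0.
    by rewrite (addrC a0 (y *m K)) addrK.
  have [|t t01 ->] := @MVT_line _ _ f a0 (y *m K).
    by move=> t t01; apply: df; exact: Ut.
  apply: (le_trans (fK _ (Ut _ t01))); apply: le_trans (ltW yd).
  by rewrite ler_wpM2r// lerDl.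
have [w1 w1d E1] := bnd rho rr.
have [|w2 w2d E2] := bnd (- rho); first by rewrite normrN.
have up : f a0 <= f (a0 + y *m K + rho *: e).
  have h : rho * d <= rho * w1 by rewrite ler_pM2l.
  move: low; rewrite ler_norml => /andP[h1 _].
  by rewrite -subr_ge0 -(subrKA (f (a0 + y *m K))) E1; lra.
have down : f (a0 + y *m K + (- rho) *: e) <= f a0.
  have h : rho * d <= rho * w2 by rewrite ler_pM2l.
  move: low; rewrite ler_norml => /andP[_ h1].
  by rewrite -subr_le0 -(subrKA (f (a0 + y *m K))) E2; lra.
have [||| c crho Ec] := @IVT _ (fun t : R => f (a0 + y *m K + t *: e)) (- rho) rho (f a0).
- by rewrite lerNl (le_trans _ (ltW rho0))// oppr_le0 ltW.
- apply: derivable_within_continuous => t; rewrite in_itv/= -ler_norml => tr.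
  by apply: derivable_line; apply: diff_derivable; apply: df; exact: U_plus.
- by rewrite ge_min down /= le_max up orbT.
by exists c; split=> //; move: crho; rewrite in_itv/= -ler_norml.
Qed.

End implicit.

Lemma half_arith (R : realFieldType) (z w : R) : z - z / 2 < w -> z / 2 <= w.
Proof. by lra. Qed.

(** F is chosen pointwise among the roots of [implicit_root], and [implicit_smooth] holds for any
    choice. The ball is shrunk so that ['D_e f] keeps at least half its value at a0 and the
    derivatives along K stay bounded. *)
Lemma implicit_function (R : realType) (n m : nat) (f : 'rV[R]_n -> R) (a0 e : 'rV[R]_n)
  (K : 'M[R]_(m, n)) (r : R) : 0 < r ->
  Cinfty_on [set b | `|b - a0| < r] f -> 0 < 'D_e f a0 ->
  exists (delta : R) (F : 'rV[R]_m -> R),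
    [/\ 0 < delta, Cinfty_on [set y | `|y| < delta] F, F 0 = 0 &
     forall y, `|y| < delta -> let b := a0 + y *m K + F y *: e in
       [/\ `|b - a0| < r, 0 < 'D_e f b & f b = f a0]].
Proof.
move=> r0 Cf De; have Ua0 : [set b : 'rV[R]_n | `|b - a0| < r] a0.
  by rewrite /= subrr normr0.
have cD u b : `|b - a0| < r -> {for b, continuous ('D_u f : _ -> R)}.
  by move=> br; apply: differentiable_continuous; exact: Cinfty_diff (Cinfty_derive u Cf) br.
pose d := 'D_e f a0 / 2; have d0 : 0 < d by rewrite divr_gt0.
have [K1 [r1 [K10 r10 H1]]] := @locally_bounded _ _ _
  (fun i : 'I_m => 'D_(delta_mx 0 i *m K) f : _ -> R) a0 (fun i => cD _ _ Ua0).
have [r2 r20 H2] := @continuous_family _ _ _ (fun=> 'D_e f : _ -> R) a0 d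
  (fun _ : unit => cD _ _ Ua0) d0.
pose r' := Num.min r (Num.min r1 r2).
have r'0 : 0 < r' by rewrite !lt_min r0 r10 r20.
have lt0 (y : R) : y < r' -> y < r by rewrite !lt_min => /and3P[].
have lt1 (y : R) : y < r' -> y < r1 by rewrite !lt_min => /and3P[].
have lt2 (y : R) : y < r' -> y < r2 by rewrite !lt_min => /and3P[].
have Cf' : Cinfty_on [set b | `|b - a0| < r'] f.
  by move=> j; apply: Ck_sub (Cf j) => b /lt0.
have df (b : 'rV[R]_n) : `|b - a0| < r' -> differentiable f b.
  exact: Cinfty_diff Cf'.
have fe (b : 'rV[R]_n) : `|b - a0| < r' -> d <= 'D_e f b.
  move=> /lt2 /(H2 tt); rewrite ltr_distl => /andP[+ _].
  by move=> h; exact: (@half_arith R ('D_e f a0) ('D_e f b) h).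
pose c1 : R := m%:R * K1; have c10 : 0 <= c1 by rewrite mulr_ge0.
have fK (b : 'rV[R]_n) (h : 'rV[R]_m) : `|b - a0| < r' -> `|'D_(h *m K) f b| <= c1 * `|h|.
  move=> br; have L : linear (fun h : 'rV[R]_m => 'D_(h *m K) f b).
    by move=> s u v; rewrite mulmxDl -scalemxAl (derive_linear (df _ br)).
  rewrite {1}[h]row_sum_delta (linear_big _ _ L) (le_trans (ler_norm_sum _ _ _))//.
  apply: (@le_trans _ _ (\sum_(i < m) (K1 * `|h|))).
    apply: ler_sum => i _; rewrite (linear_scale L) normrZ mulrC.
    by rewrite ler_pM ?coord_le_norm// (H1 i)// lt1.
  by rewrite sumr_const card_ord -[leLHS]mulr_natl mulrA.
have [k k0 Kk] := linear_lipschitz (@continuous_linear_rV _ _ _ (mulmxr K)).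
have e1 : 0 < `|e| + 1 by rewrite ltr_wpDl.
(* Displacements along e use at most half of the radius r'; the other half is left for [y *m K]. *)
pose rho := r' / 2 / (`|e| + 1).
have rho0 : 0 < rho by rewrite !divr_gt0.
have rhoe : rho * `|e| < r' / 2.
  by rewrite /rho mulrAC ltr_pdivrMr// ltr_pM2l ?divr_gt0// ltrDl.
have c11 : 0 < c1 + 1 by rewrite ltr_wpDl.
(* The first bound keeps [y *m K] within r' / 2, the second keeps its effect on f below rho d. *)
pose delta := Num.min (r' / 2 / k) (rho * d / (c1 + 1)).
have delta0 : 0 < delta by rewrite lt_min !divr_gt0// mulr_gt0.
have Dk (y : 'rV[R]_m) : `|y| < delta -> k * `|y| < r' / 2 /\ (c1 + 1) * `|y| < rho * d.
  rewrite lt_min => /andP[h1 h2]; split; rewrite mulrC.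
    by rewrite -ltr_pdivlMr.
  by rewrite -ltr_pdivlMr.
have ex y : exists u : R, `|y| < delta -> `|u| <= rho /\ f (a0 + y *m K + u *: e) = f a0.
  have [/Dk[h1 h2]|h] := ltP `|y| delta; last by exists 0.
  have [u hu] := implicit_root r'0 df fe fK Kk rho0 rhoe h1 h2.
  by exists u.
pose F y := projT1 (cid (ex y)).
have HF y : `|y| < delta -> `|F y| <= rho /\ f (a0 + y *m K + F y *: e) = f a0.
  exact: projT2 (cid (ex y)).
have inU (y : 'rV[R]_m) : `|y| < delta -> `|a0 + y *m K + F y *: e - a0| < r'.
  move=> yd; have [h1 h2] := Dk y yd; have [h3 _] := HF y yd.
  rewrite -(addrA a0) (addrC a0) addrK (le_lt_trans (ler_normD _ _))// (splitr r').
  apply: ltrD; first exact: le_lt_trans (Kk y) h1.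
  by rewrite normrZ (le_lt_trans _ rhoe)// ler_wpM2r.
exists delta, F; split=> //.
- apply: (implicit_smooth Cf' d0 fe c10 fK (ltW k0) Kk inU) => y yd.
  by have [] := HF y yd.
(* F 0 is some root on the line through a0 in the direction e. As ['D_e f] does not vanish there,
   the mean value theorem leaves only 0. *)
- have z : `|0 : 'rV[R]_m| < delta by rewrite normr0.
  have [h1 h2] := HF 0 z; have h3 := inU 0 z; move: h2 h3; rewrite mul0mx addr0 => h2 h3.
  have Ua0' : `|a0 - a0| < r' by rewrite subrr normr0.
  have Ut (t : R) : 0 <= t <= 1 -> `|a0 + t *: (F 0 *: e) - a0| < r'.
    by move=> t01; have := ball_convex t01 Ua0' h3; rewrite (addrC a0 (F 0 *: e)) addrK.
  have [|t t01] := @MVT_line _ _ f a0 (F 0 *: e).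
    by move=> t t01; apply: df; exact: Ut.
  rewrite h2 subrr derive_scalev; last by apply: df; exact: Ut.
  move/esym/eqP; rewrite /GRing.scale/= mulf_eq0 => /orP[/eqP//|/eqP D0].
  by have := fe _ (Ut t t01); rewrite D0 leNgt d0.
- move=> y yd; have h := inU y yd; split; first exact: lt0.
    exact: lt_le_trans d0 (fe _ h).
  by have [] := HF y yd.
Qed.

(** * Embedding a vector space in a small ball by arctangents *)

Section squash.
Context {R : realType}.

Lemma Ck_mul n k (U : set 'rV[R]_n) (f g : 'rV[R]_n -> R) :
  open U -> Ck_on k U f -> Ck_on k U g -> Ck_on k U (fun a => f a * g a).
Proof. exact: Ck_scale. Qed.

Lemma Ck_coordl n k (U : set 'rV[R]_n) i : Ck_on k U (fun y : 'rV[R]_n => y 0 i : R).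
Proof. exact: (Ck_linear _ _ (coordl i)). Qed.

Lemma derive_atan_coord n (i : 'I_n) (y v : 'rV[R]_n) :
  differentiable (fun y : 'rV[R]_n => atan (y 0 i) : R) y /\
  'D_v (fun y : 'rV[R]_n => atan (y 0 i) : R) y = (1 + (y 0 i) ^+ 2)^-1 * v 0 i.
Proof.
have dc : differentiable (fun y : 'rV[R]_n => y 0 i : R) y by exact: differentiable_coord.
have da : differentiable (@atan R) (y 0 i) by exact/derivable1_diffP/derivable_atan.
split; first exact: (differentiable_comp dc da).
refine (etrans (derive_comp v dc da) _).
rewrite (derive_coord v i (differentiable_id y)) derive_id.
rewrite -[X in 'D_X _ _]mulr1 (derive_scalev (v 0 i) (1 : R) da) -derive1E derive1_atan.
by rewrite /GRing.scale/= mulrC.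
Qed.

Lemma Cinfty_atan_coord n (i : 'I_n) :
  Cinfty_on [set: 'rV[R]_n] (fun y : 'rV[R]_n => atan (y 0 i) : R).
Proof.
case=> [|k].
  by move=> y _; apply: differentiable_continuous; have [] := derive_atan_coord i y 0.
split=> [y _|v]; first by have [] := derive_atan_coord i y 0.
have H : Ck_on k [set: 'rV[R]_n] (fun y : 'rV[R]_n => (1 + y 0 i * y 0 i)^-1 * v 0 i).
  apply: (Ck_mul openT); last exact: Ck_cst.
  apply: (Ck_inv openT).
    by move=> y _; rewrite lt0r_neq0// ltr_pwDl// -expr2 sqr_ge0.
  apply: (Ck_add openT); first exact: Ck_cst.
  by apply: (Ck_mul openT); exact: Ck_coordl.
apply: Ck_eq openT _ H => y _.
by have [_ ->] := derive_atan_coord i y v.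
Qed.

(* Allows a graph over a ball to be parametrised by a whole vector space, so that a
   single identity chart makes it a manifold. *)
Lemma ball_parametrization m (delta : R) : 0 < delta -> exists rho : 'rV[R]_m -> 'rV[R]_m,
  [/\ Cinfty_on setT rho, forall y, `|rho y| < delta, injective rho, rho 0 = 0 &
   forall y, (forall h, exists u, 'D_u rho y = h) /\ (forall u, 'D_u rho y = 0 -> u = 0)].
Proof.
move=> delta0; pose s := delta / pi.
(* As |atan| < pi / 2, the scale delta / pi bounds every coordinate, hence the sup norm, by delta /
   2. *)
have s0 : 0 < s by rewrite divr_gt0// pi_gt0.
pose rho (y : 'rV[R]_m) : 'rV[R]_m := \row_i (s * atan (y 0 i)).
have rhoE y i : rho y 0 i = s * atan (y 0 i) by rewrite mxE.
have Cr : Cinfty_on setT rho.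
  move=> k; apply: (Ck_rV openT) => i.
  rewrite (_ : (fun a => _) = (fun y : 'rV[R]_m => s * atan (y 0 i))); last first.
    by apply/funext => y; rewrite rhoE.
  by apply: (Ck_mul openT); [exact: Ck_cst|exact: Cinfty_atan_coord].
have Dr y u i : 'D_u rho y 0 i = s * ((1 + (y 0 i) ^+ 2)^-1 * u 0 i).
  rewrite -(derive_coord u i (Cinfty_diff Cr (a := y) I)).
  have [d E] := derive_atan_coord i y u.
  rewrite (_ : (fun a => _) = (fun y : 'rV[R]_m => s *: (atan (y 0 i) : R))); last first.
    by apply/funext => z; rewrite rhoE.
  have := @deriveZ _ _ _ (fun y : 'rV[R]_m => atan (y 0 i) : R) s y u (diff_derivable d).
  by rewrite E.
have p0 (z : R) : (1 + z ^+ 2)^-1 != 0.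
  by rewrite invr_neq0// lt0r_neq0// ltr_pwDl// sqr_ge0.
exists rho; split=> //.
- move=> y; apply: (@le_lt_trans _ _ (delta / 2)); last by rewrite ltr_pdivrMr// ltr_pMr// ltr1n.
  rewrite [leLHS]/Num.Def.normr/= mx_normrE; apply: bigmax_le; first by rewrite ltW// divr_gt0.
  move=> [i0 i] _ /=.
  rewrite (ord1 i0) rhoE normrM (gtr0_norm s0).
  have -> : delta / 2 = s * (pi / 2) by rewrite /s mulrA divfK// lt0r_neq0// pi_gt0.
  apply: ler_wpM2l; first exact: ltW.
  rewrite ler_norml; apply/andP; split; apply: ltW; [exact: atan_gtNpi2|exact: atan_ltpi2].
- move=> y y' E; apply/rowP => i; have /rowP/(_ i) := E; rewrite !rhoE.
  by move/(mulfI (lt0r_neq0 s0))/(can_inj (@atanK R)).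
- by apply/rowP => i; rewrite rhoE mxE atan0 mulr0.
- move=> y; split=> [h|u /rowP E].
    exists (\row_i (h 0 i / (s * (1 + (y 0 i) ^+ 2)^-1))); apply/rowP => i.
    by rewrite Dr mxE mulrA mulrC divfK// mulf_neq0// lt0r_neq0.
  apply/rowP => i; have := E i; rewrite Dr !mxE mulrA => /eqP.
  have ne : s * (1 + y 0 i ^+ 2)^-1 != 0 by apply: mulf_neq0 => //; exact: lt0r_neq0.
  by rewrite mulf_eq0 (negbTE ne) => /eqP.
Qed.

End squash.

(** * A vector space as a manifold with the identity chart *)

Section rV_manifold.
Context {R : realType} (m : nat).

Lemma rV_second_countable : @second_countable 'rV[R]_m.
Proof.
pose b (p : 'rV[rat]_m * rat) : set 'rV[R]_m :=
  [set y | `|y - map_mx ratr p.1| < ratr p.2].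
exists (range b).
  exact: sub_countable (card_image_le _ _) (countableP _).
split=> [_ [p _ <-]|x V /nbhs_ballP[eps /= eps0 HV]].
  exact: open_norm_ball.
have e2 : 0 < eps / 2 by rewrite divr_gt0.
(* With a rational radius s < eps / 2 and a rational centre within s / 2 of x, the ball contains x
   and stays within 2 s < eps of it. *)
have [q [s [sq s0 se]]] : exists (q : rat) (s : R), [/\ ratr q = s, 0 < s & s < eps / 2].
  by have [q /itvP hq] := rat_in_itvoo e2; exists q, (ratr q); rewrite !hq.
have s2 : 0 < s / 2 by rewrite divr_gt0.
have H i : exists c : rat, `|x 0 i - ratr c| < s / 2.
  have /rat_in_itvoo[c /itvP hc] : x 0 i - s / 2 < x 0 i + s / 2.
    by rewrite ltrBlDr -addrA ltrDl addr_gt0.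
  by exists c; rewrite distrC ltr_distl !hc.
pose z : 'rV[rat]_m := \row_i projT1 (cid (H i)).
have xz : `|x - map_mx ratr z| < s.
  apply: (@le_lt_trans _ _ (s / 2)); last by rewrite ltr_pdivrMr// ltr_pMr// ltr1n.
  rewrite [leLHS]/Num.Def.normr/= mx_normrE; apply: bigmax_le; first exact: ltW.
  move=> [i0 i] _ /=.
  by rewrite (ord1 i0) !mxE ltW//; exact: projT2 (cid (H i)).
exists (b (z, q)); first by split; [exists (z, q)|rewrite /b /= sq].
move=> y; rewrite /b /= sq => yz; apply: HV; rewrite -ball_normE /=.
rewrite -(subrKA (map_mx ratr z)) (le_lt_trans (ler_normD _ _))// (splitr eps).
by apply: ltrD; [apply: lt_trans xz _|rewrite distrC; apply: lt_trans yz _].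
Qed.

Lemma rV_connected : connected [set: 'rV[R]_m].
Proof.
have -> : [set: 'rV[R]_m] = \bigcup_(y in [set: 'rV[R]_m]) range (fun t : R => t *: y).
  by apply/seteqP; split=> // y _; exists y => //; exists 1; rewrite ?scale1r.
apply: bigcup_connected.
  by exists 0 => y _; exists 0; rewrite ?scale0r.
move=> y _; apply: connected_continuous_connected.
  by rewrite -set_itvNyy; apply/connected_intervalP; exact: interval_is_interval.
by apply: continuous_subspaceT; exact: scalel_continuous.
Qed.

Definition rV_manifold : manifold R m.
Proof.
refine (@Manifold R m 'rV[R]_m (fun=> setT) (fun=> id) (fun=> id)
  (@norm_hausdorff _ _) rV_second_countable rV_connected _ _ _ _ _ _ _).
- by [].
- by move=> _; exact: openT.
- by move=> _; rewrite image_id; exact: openT.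
- by [].
- by move=> _ p _; exact: cvg_id.
- by move=> _ p _; exact: cvg_id.
- by move=> _ _ k; exact: (Ck_linear _ _ (@idfun 'rV[R]_m)).
Defined.

End rV_manifold.

(** * Charts, frames and vector fields *)

Section Manifold.
Context {R : realType}.
Implicit Types V W : normedModType R.

Lemma chart_open n (M : manifold R n) (c : M) (U : set M) :
  open U -> open (coord c @` (cdom c `&` U)).
Proof.
move=> oU; rewrite openE => _ [p [cp Up] <-]; rewrite /interior.
have h1 : nbhs (coord c p) (coord c @` cdom c).
  by apply: open_nbhs_nbhs; split; [exact: cimg_open|exists p].
have h2 : nbhs (coord c p) (cinv c @^-1` U).
  apply: (@cinv_continuous _ _ M c (coord c p)); first by exists p.
  by rewrite coordK//; exact: open_nbhs_nbhs.
apply: filterS (filterI h1 h2) => a [[q cq <-]] /=; rewrite coordK// => Uq.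
by exists q.
Qed.

Arguments chart_open {n M} c {U}.

Lemma mem_chart n (M : manifold R n) (c p : M) (U : set M) :
  cdom c p -> U p -> (coord c @` (cdom c `&` U)) (coord c p).
Proof. by move=> cp Up; exists p. Qed.

Lemma chart_eq n (M : manifold R n) V (c : M) (U : set M) (f g : M -> V) :
  (forall q, U q -> f q = g q) ->
  forall a, (coord c @` (cdom c `&` U)) a -> (f \o cinv c) a = (g \o cinv c) a.
Proof. by move=> fg _ [q [cq Uq] <-] /=; rewrite coordK//; exact: fg. Qed.

Lemma smooth_on_sub n (M : manifold R n) V (U U' : set M) (f : M -> V) :
  U' `<=` U -> smooth_on U f -> smooth_on U' f.
Proof.
move=> UU sf c k; apply: Ck_sub (sf c k) => _ [q [cq Uq] <-].
by exists q => //; split=> //; exact: UU.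
Qed.

Lemma smooth_on_eq n (M : manifold R n) V (U : set M) (f g : M -> V) :
  open U -> (forall q, U q -> f q = g q) -> smooth_on U f -> smooth_on U g.
Proof.
move=> oU fg sf c k; apply: Ck_eq (sf c k); first exact: chart_open.
exact: chart_eq.
Qed.

Lemma chart_change n (M : manifold R n) V (c c' : M) (f : M -> V) (a : 'rV[R]_n) :
  (coord c' @` (cdom c' `&` cdom c)) a ->
  (f \o cinv c \o (coord c \o cinv c')) a = (f \o cinv c') a.
Proof. by move=> [q [cq c'q] <-] /=; rewrite !coordK. Qed.

(** [smooth_on] asks for smoothness in every preferred chart; the transition maps reduce it to one
    chart of choice near each point. *)
Lemma smooth_on_chart n (M : manifold R n) V (U : set M) (f : M -> V) : open U ->
  (forall p, U p -> exists (c : M) (W : set M), [/\ open W, W p, cdom c p &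
     Cinfty_on (coord c @` (cdom c `&` W)) (f \o cinv c)]) ->
  smooth_on U f.
Proof.
move=> oU H c' k; apply: Ck_local => _ [p [c'p Up] <-].
have [c [W [oW Wp cp Cf]]] := H p Up.
have oD := chart_open c' (openI (cdom_open c) oW).
exists (coord c' @` (cdom c' `&` (cdom c `&` W))); first exact: mem_chart.
apply: (@Ck_eq _ _ _ _ _ ((f \o cinv c) \o (coord c \o cinv c'))) => //.
  by move=> a [q [c'q [cq Wq]] <-]; apply: chart_change; exists q.
apply: (Ck_comp oD (chart_open c oW)) (Cf k).
  by move=> _ [q [c'q [cq Wq]] <-] /=; rewrite coordK//; exact: mem_chart.
apply: Ck_sub (@transition_smooth _ _ M c' c k) => _ [q [c'q [cq Wq]] <-].
by exists q.
Qed.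

Lemma smooth_on_diff n (M : manifold R n) V (U : set M) (f : M -> V) c p :
  smooth_on U f -> U p -> cdom c p -> differentiable (f \o cinv c) (coord c p).
Proof. by move=> sf Up cp; apply: Cinfty_diff (sf c) _; exact: mem_chart. Qed.

Lemma smooth_coord n (M : manifold R n) (c : M) : smooth_on (cdom c) (coord c).
Proof. by move=> c' k; exact: transition_smooth. Qed.

Lemma dirder_eq n (M : manifold R n) V (U : set M) (f g : M -> V) p v :
  open U -> U p -> (forall q, U q -> f q = g q) -> dirder f p v = dirder g p v.
Proof.
move=> oU Up fg; apply: near_eq_derive.
apply: open_near_eq (chart_open p oU) _ _; last exact: chart_eq.
exact: mem_chart (cdom_center p) Up.
Qed.

(* The field with constant components u in the chart at c. *)
Definition frame n (M : manifold R n) (c : M) (u : 'rV[R]_n) (q : M) : 'rV[R]_n :=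
  'D_u (coord q \o cinv c) (coord c q).

(** Tangent vectors at p are read in the chart at p. In the chart at c the components of v are the
    derivative of the transition map applied to v. *)
Lemma dirder_chart n (M : manifold R n) V (U : set M) (f : M -> V) c p v :
  open U -> smooth_on U f -> U p -> cdom c p ->
  dirder f p v = 'D_(dirder (coord c) p v) (f \o cinv c) (coord c p).
Proof.
move=> oU sf Up cp; rewrite /dirder.
have E : cinv p (coord p p) = p by rewrite coordK//; exact: cdom_center.
have df : differentiable (f \o cinv c) ((coord c \o cinv p) (coord p p)).
  by rewrite /= E; exact: smooth_on_diff sf Up cp.
have dc : differentiable (coord c \o cinv p) (coord p p).
  exact: smooth_on_diff (@smooth_coord _ M c) cp (cdom_center p).
transitivity ('D_v ((f \o cinv c) \o (coord c \o cinv p)) (coord p p)); last first.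
  by rewrite (derive_comp v dc df) /= E.
apply: near_eq_derive; apply: open_near_eq (chart_open p (cdom_open c)) _ _.
  exact: mem_chart (cdom_center p) cp.
by move=> a h; rewrite chart_change.
Qed.

Lemma dirder_frame n (M : manifold R n) V (U : set M) (f : M -> V) c p u :
  open U -> smooth_on U f -> U p -> cdom c p ->
  dirder f p (frame c u p) = 'D_u (f \o cinv c) (coord c p).
Proof.
move=> oU sf Up cp; rewrite /dirder /frame.
have E : cinv c (coord c p) = p by rewrite coordK.
have df : differentiable (f \o cinv p) ((coord p \o cinv c) (coord c p)).
  by rewrite /= E; exact: smooth_on_diff sf Up (cdom_center p).
have dc : differentiable (coord p \o cinv c) (coord c p).
  exact: smooth_on_diff (@smooth_coord _ M p) (cdom_center p) cp.
transitivity ('D_u ((f \o cinv p) \o (coord p \o cinv c)) (coord c p)).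
  by rewrite (derive_comp u dc df) /= E.
apply: near_eq_derive; apply: open_near_eq (chart_open c (cdom_open p)) _ _.
  exact: mem_chart cp (cdom_center p).
by move=> a h; rewrite chart_change.
Qed.

Lemma derive_chart_id n (M : manifold R n) (c p : M) u : cdom c p ->
  'D_u (coord c \o cinv c) (coord c p) = u.
Proof.
move=> cp; transitivity ('D_u id (coord c p)); last exact: derive_id.
apply: near_eq_derive; apply: open_near_eq (chart_open c openT) _ _.
  exact: mem_chart.
by move=> _ [q [cq _] <-] /=; rewrite coordK.
Qed.

Lemma dirder_coord_frame n (M : manifold R n) (c p : M) u : cdom c p ->
  dirder (coord c) p (frame c u p) = u.
Proof.
move=> cp; rewrite (dirder_frame u (cdom_open c) (@smooth_coord _ M c) cp cp).
exact: derive_chart_id.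
Qed.

Lemma frame_center n (M : manifold R n) (p : M) u : frame p u p = u.
Proof. exact: derive_chart_id (cdom_center p). Qed.

Lemma frame_dirder_coord n (M : manifold R n) (c p : M) v : cdom c p ->
  frame c (dirder (coord c) p v) p = v.
Proof.
move=> cp; rewrite /frame -(dirder_chart v (cdom_open p) (@smooth_coord _ M p) (cdom_center p) cp).
exact: derive_chart_id (cdom_center p).
Qed.

Lemma frame_linear n (M : manifold R n) (c p : M) : cdom c p ->
  linear (fun u => frame c u p).
Proof.
move=> cp; apply: derive_linear.
exact: smooth_on_diff (@smooth_coord _ M p) (cdom_center p) cp.
Qed.

Lemma dirder_linear n (M : manifold R n) V (U : set M) (f : M -> V) p :
  smooth_on U f -> U p -> linear (dirder f p).
Proof.
move=> sf Up; apply: derive_linear.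
exact: smooth_on_diff sf Up (cdom_center p).
Qed.

Section closure.
Context n (M : manifold R n) (U : set M) (oU : open U).
Implicit Types (p : M) (v : 'rV[R]_n).

Lemma smooth_cst V (a : V) : smooth_on U (fun=> a).
Proof. by move=> c k; exact: Ck_cst. Qed.

Lemma smooth_add V (f g : M -> V) :
  smooth_on U f -> smooth_on U g -> smooth_on U (fun q => f q + g q).
Proof. by move=> sf sg c k; exact: (Ck_add (chart_open c oU) (sf c k) (sg c k)). Qed.

Lemma smooth_scale V (f : M -> R) (g : M -> V) :
  smooth_on U f -> smooth_on U g -> smooth_on U (fun q => f q *: g q).
Proof. by move=> sf sg c k; exact: (Ck_scale (chart_open c oU) (sf c k) (sg c k)). Qed.

Lemma smooth_comp_coord m (f : M -> 'rV[R]_m) i :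
  smooth_on U f -> smooth_on U (fun q => f q 0 i : R).
Proof.
move=> sf c k.
exact: (@Ck_coord _ _ _ _ _ (f \o cinv c) i (chart_open c oU) (sf c k)).
Qed.

Lemma dirder_add V (f g : M -> V) p v : smooth_on U f -> smooth_on U g -> U p ->
  dirder (fun q => f q + g q) p v = dirder f p v + dirder g p v.
Proof.
move=> sf sg Up; have cp := cdom_center p.
have df := smooth_on_diff sf Up cp; have dg := smooth_on_diff sg Up cp.
exact: (@deriveD _ _ _ (f \o cinv p) (g \o cinv p) (coord p p) v
  (diff_derivable df) (diff_derivable dg)).
Qed.

Lemma dirder_scale V (f : M -> R) (g : M -> V) p v :
  smooth_on U f -> smooth_on U g -> U p ->
  dirder (fun q => f q *: g q) p v = f p *: dirder g p v + dirder f p v *: g p.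
Proof.
move=> sf sg Up; have cp := cdom_center p.
have df := smooth_on_diff sf Up cp; have dg := smooth_on_diff sg Up cp.
by have := derive_scale v df dg; rewrite /dirder /= coordK.
Qed.

Lemma dirder_comp_coord m (f : M -> 'rV[R]_m) p v i :
  smooth_on U f -> U p -> dirder (fun q => f q 0 i : R) p v = dirder f p v 0 i.
Proof.
move=> sf Up; have cp := cdom_center p.
exact: derive_coord v i (smooth_on_diff sf Up cp).
Qed.

Lemma dirder_cst V (a : V) p v : dirder (fun=> a) p v = 0.
Proof. exact: derive_cst. Qed.

End closure.

Lemma smooth_map_open m n (M : manifold R m) (M' : manifold R n) (x : M -> M')
  (V : set M') : smooth_map x -> open V -> open (x @^-1` V).
Proof. by move=> [cx _] oV; move/continuousP: cx; exact. Qed.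

Lemma smooth_idfun n (M : manifold R n) : smooth_map (@idfun M).
Proof. by split; [move=> p; exact: cvg_id|move=> c; exact: smooth_coord]. Qed.

Section comp.
Context m n (M : manifold R m) (M' : manifold R n) (x : M -> M').
Context (sx : smooth_map x).

Lemma smooth_comp W (V : set M') (f : M' -> W) :
  open V -> smooth_on V f -> smooth_on (x @^-1` V) (f \o x).
Proof.
move=> oV sf; apply: smooth_on_chart; first exact: smooth_map_open.
move=> p Vp; exists p, (x @^-1` (cdom (x p) `&` V)).
have oD : open (x @^-1` (cdom (x p) `&` V)).
  by apply: smooth_map_open => //; apply: openI => //; exact: cdom_open.
split => //; first by split => //; exact: cdom_center.
  exact: cdom_center.
move=> k.
apply: (@Ck_eq _ _ _ _ _ ((f \o cinv (x p)) \o (coord (x p) \o x \o cinv p))).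
- exact: chart_open.
- by move=> _ [q [cq [/= xq Vq]] <-] /=; rewrite coordK// coordK.
apply: (Ck_comp (chart_open p oD) (chart_open (x p) oV)) (sf (x p) k).
  by move=> _ [q [cq [/= xq Vq]] <-] /=; rewrite coordK//; exact: mem_chart.
have [_ sc] := sx; apply: Ck_sub (sc (x p) p k) => _ [q [cq [/= xq Vq]] <-].
by exists q.
Qed.

Lemma smooth_map_diff p : differentiable (coord (x p) \o x \o cinv p) (coord p p).
Proof.
have [_ sc] := sx; apply: smooth_on_diff (sc (x p)) _ (cdom_center p).
exact: cdom_center.
Qed.

Lemma dmap_linear p : linear (dmap x p).
Proof. by apply: derive_linear; exact: smooth_map_diff. Qed.

Lemma dirder_comp W (V : set M') (f : M' -> W) p v :
  open V -> smooth_on V f -> V (x p) ->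
  dirder (f \o x) p v = dirder f (x p) (dmap x p v).
Proof.
move=> oV sf Vp; rewrite /dirder /dmap /dirder.
have E : cinv p (coord p p) = p by rewrite coordK//; exact: cdom_center.
have df : differentiable (f \o cinv (x p)) ((coord (x p) \o x \o cinv p) (coord p p)).
  by rewrite /= E; exact: smooth_on_diff sf Vp (cdom_center (x p)).
transitivity ('D_v ((f \o cinv (x p)) \o (coord (x p) \o x \o cinv p)) (coord p p)); last first.
  by rewrite (derive_comp v (smooth_map_diff p) df) /= E.
have oD := smooth_map_open sx (cdom_open (x p)).
apply: near_eq_derive; apply: open_near_eq (chart_open p oD) _ _.
  by apply: mem_chart; exact: cdom_center.
by move=> _ [q [cq /= xq] <-] /=; rewrite coordK// coordK.
Qed.

Lemma dmap_add p u v : dmap x p (u + v) = dmap x p u + dmap x p v.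
Proof. exact: linear_plus (dmap_linear p) u v. Qed.

Lemma dmap_scale p a u : dmap x p (a *: u) = a *: dmap x p u.
Proof. exact: linear_scale (dmap_linear p) a u. Qed.

Lemma dmap0 p : dmap x p 0 = 0.
Proof. exact: linear_zero (dmap_linear p). Qed.

Lemma dmap_sub p u v : dmap x p (u - v) = dmap x p u - dmap x p v.
Proof. exact: linear_subr (dmap_linear p) u v. Qed.

End comp.

End Manifold.
Arguments chart_open {R n M} c {U}.

(** Inverse of [frame c _ y]: the vector w, given in the chart at y, read in the chart at c. *)
Definition comps (R : realType) n (M : manifold R n) (c y : M) (w : 'rV[R]_n) : 'rV[R]_n :=
  dirder (coord c) y w.

Section Fields.
Context {R : realType}.
Implicit Types V W : normedModType R.

Lemma smooth_rV n m (M : manifold R n) (U : set M) (f : M -> 'rV[R]_m) : open U ->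
  (forall i, smooth_on U (fun q => f q 0 i : R)) -> smooth_on U f.
Proof.
move=> oU sf c k; apply: Ck_rV; first exact: chart_open.
by move=> i; exact: sf.
Qed.

Lemma smooth_frame_dirder n (M : manifold R n) V (U : set M) (f : M -> V) c u :
  open U -> smooth_on U f ->
  smooth_on (cdom c `&` U) (fun q => dirder f q (frame c u q)).
Proof.
move=> oU sf; have oD := openI (cdom_open c) oU.
apply: (@smooth_on_eq _ _ _ _ _ ('D_u (f \o cinv c) \o coord c)) => //.
  by move=> q [cq Uq]; rewrite (dirder_frame u oU sf Uq cq).
apply: smooth_on_chart => // p [cp Up]; exists c, U; split => // k.
apply: (@Ck_eq _ _ _ _ _ ('D_u (f \o cinv c) : _ -> V)); first exact: chart_open.
  by move=> _ [q [cq _] <-] /=; rewrite coordK.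
exact: Cinfty_derive (sf c) k.
Qed.

Section along.
Context m n (M : manifold R m) (M' : manifold R n) (x : M -> M').
Context (sx : smooth_map x).
Implicit Types (U : set M) (Z : M -> 'rV[R]_n).

Lemma along_sub U U' Z : U' `<=` U -> smooth_along x U Z -> smooth_along x U' Z.
Proof.
move=> UU sZ V f oV sf; apply: smooth_on_sub (sZ V f oV sf) => q [Uq Vq].
by split=> //; exact: UU.
Qed.

Lemma along_eq U Z Z' : open U -> (forall q, U q -> Z q = Z' q) ->
  smooth_along x U Z -> smooth_along x U Z'.
Proof.
move=> oU ZZ sZ V f oV sf; apply: smooth_on_eq (sZ V f oV sf).
  by apply: openI => //; exact: smooth_map_open.
by move=> q [Uq _]; rewrite ZZ.
Qed.

Lemma along_add U Z Z' : open U -> smooth_along x U Z -> smooth_along x U Z' ->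
  smooth_along x U (fun q => Z q + Z' q).
Proof.
move=> oU sZ sZ' V f oV sf.
have oD : open (U `&` x @^-1` V) by apply: openI => //; exact: smooth_map_open.
apply: smooth_on_eq (smooth_add oD (sZ V f oV sf) (sZ' V f oV sf)) => //.
move=> q [Uq Vq]; have L := dirder_linear sf Vq.
by have := L 1 (Z q) (Z' q); rewrite !scale1r.
Qed.

Lemma along_scale U (h : M -> R) Z : open U -> smooth_on U h -> smooth_along x U Z ->
  smooth_along x U (fun q => h q *: Z q).
Proof.
move=> oU sh sZ V f oV sf.
have oD : open (U `&` x @^-1` V) by apply: openI => //; exact: smooth_map_open.
have sh' : smooth_on (U `&` x @^-1` V) h by apply: smooth_on_sub sh => q [].
apply: smooth_on_eq (smooth_scale oD sh' (sZ V f oV sf)) => //.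
move=> q [Uq Vq]; have L := dirder_linear sf Vq.
by have := L (h q) (Z q) 0; rewrite !addr0 [dirder f (x q) 0]derive0 addr0.
Qed.

Lemma along_vec U Z (V : set M') k (f : M' -> 'rV[R]_k) : open U -> open V ->
  smooth_along x U Z -> smooth_on V f ->
  smooth_on (U `&` x @^-1` V) (fun q => dirder f (x q) (Z q)).
Proof.
move=> oU oV sZ sf.
have oD : open (U `&` x @^-1` V) by apply: openI => //; exact: smooth_map_open.
apply: smooth_rV => // i.
apply: smooth_on_eq (sZ V _ oV (smooth_comp_coord oV i sf)) => //.
by move=> q [Uq Vq]; exact: dirder_comp_coord sf Vq.
Qed.

Lemma along_field (V : set M') (Z : M' -> 'rV[R]_n) : open V -> smooth_field V Z ->
  smooth_along x (x @^-1` V) (Z \o x).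
Proof.
move=> oV sZ V' f oV' sf.
have s : smooth_on (V `&` V') (fun q => dirder f q (Z q)) by exact: sZ.
exact: (smooth_comp sx (openI oV oV') s).
Qed.

Lemma along_dmap U (Y : M -> 'rV[R]_m) : open U -> smooth_field U Y ->
  smooth_along x U (fun q => dmap x q (Y q)).
Proof.
move=> oU sY V f oV sf.
have oD : open (U `&` x @^-1` V) by apply: openI => //; exact: smooth_map_open.
apply: smooth_on_eq (sY _ _ (smooth_map_open sx oV) (smooth_comp sx oV sf)) => //.
by move=> q [Uq Vq]; exact: (dirder_comp sx (Y q) oV sf Vq).
Qed.

End along.

Lemma smooth_frame n (M : manifold R n) (c : M) u : smooth_field (cdom c) (frame c u).
Proof. by move=> V f oV sf; exact: smooth_frame_dirder. Qed.

Lemma dirder_coord_center n (M : manifold R n) (p : M) v : dirder (coord p) p v = v.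
Proof. exact: derive_chart_id v (cdom_center p). Qed.

Lemma frame_add n (M : manifold R n) (c y : M) (u w : 'rV[R]_n) : cdom c y ->
  frame c (u + w) y = frame c u y + frame c w y.
Proof. by move=> cy; exact: (linear_plus (frame_linear cy)). Qed.

Lemma frame_scale n (M : manifold R n) (c y : M) k (u : 'rV[R]_n) : cdom c y ->
  frame c (k *: u) y = k *: frame c u y.
Proof. by move=> cy; exact: (linear_scale (frame_linear cy)). Qed.

Lemma frame0 n (M : manifold R n) (c y : M) : cdom c y -> frame c (0 : 'rV[R]_n) y = 0.
Proof. by move=> cy; exact: (linear_zero (frame_linear cy)). Qed.

Lemma comps_linear n (M : manifold R n) (c y : M) : cdom c y -> linear (comps c y).
Proof. exact: dirder_linear (@smooth_coord _ _ M c). Qed.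

Lemma comps_add n (M : manifold R n) (c y : M) (u w : 'rV[R]_n) : cdom c y ->
  comps c y (u + w) = comps c y u + comps c y w.
Proof. by move=> cy; exact: (linear_plus (comps_linear cy)). Qed.

Lemma comps_scale n (M : manifold R n) (c y : M) k (u : 'rV[R]_n) : cdom c y ->
  comps c y (k *: u) = k *: comps c y u.
Proof. by move=> cy; exact: (linear_scale (comps_linear cy)). Qed.

Lemma comps_frame n (M : manifold R n) (c y : M) u : cdom c y -> comps c y (frame c u y) = u.
Proof. exact: dirder_coord_frame. Qed.

Lemma frame_comps n (M : manifold R n) (c y : M) w : cdom c y -> frame c (comps c y w) y = w.
Proof. exact: frame_dirder_coord. Qed.

Lemma comps_center n (M : manifold R n) (c : M) w : comps c c w = w.
Proof. exact: dirder_coord_center. Qed.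

Lemma comps_dmap m n (M : manifold R m) (M' : manifold R n) (x : M -> M') c p v :
  smooth_map x -> cdom c (x p) -> comps c (x p) (dmap x p v) = dirder (coord c \o x) p v.
Proof.
move=> sx cx; exact: esym (dirder_comp sx v (cdom_open c) (@smooth_coord _ _ M' c) cx).
Qed.

(** * The Lie bracket as a commutator of derivations *)

Section bracket.
Context n (M : manifold R n) (U : set M) (oU : open U).
Implicit Types X Y : M -> 'rV[R]_n.

Lemma dirder_dirder k (f : M -> 'rV[R]_k) Y p v : smooth_field U Y ->
  smooth_on U f -> U p ->
  dirder (fun q => dirder f q (Y q)) p v =
    'D_v ('D_(Y p) (f \o cinv p)) (coord p p) +
    dirder f p (dirder (fun q => dirder (coord p) q (Y q)) p v).
Proof.
move=> sY sf Up; pose Yt q := dirder (coord p) q (Y q); have cp := cdom_center p.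
have oD := openI oU (cdom_open p).
have sYt : smooth_on (U `&` cdom p) Yt.
  exact: (along_vec (@smooth_idfun _ _ M) oU (cdom_open p) sY (@smooth_coord _ _ M p)).
have dY : differentiable (Yt \o cinv p) (coord p p) by exact: (smooth_on_diff sYt (conj Up cp) cp).
have E := derive_along_field v (chart_open p oU) (mem_chart cp Up) (sf p 2%N) dY.
have E0 : (Yt \o cinv p) (coord p p) = Y p by rewrite /= coordK//; exact: dirder_coord_center.
rewrite E0 in E; refine (etrans _ E).
apply: near_eq_derive; apply: open_near_eq (chart_open p oD) (mem_chart cp (conj Up cp)) _.
move=> _ [q [Uq pq] <-]; rewrite /comp (coordK Uq).
exact: dirder_chart (Y q) oU sf pq.1 pq.2.
Qed.

(** [lie_bracket] is defined through coordinate functions alone. For a general f, [dirder_dirder]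
    isolates the second-derivative terms, which cancel by symmetry. *)
Lemma dirder_bracket k (f : M -> 'rV[R]_k) X Y p : smooth_field U X ->
  smooth_field U Y -> smooth_on U f -> U p ->
  dirder (fun q => dirder f q (Y q)) p (X p) -
  dirder (fun q => dirder f q (X q)) p (Y p) = dirder f p (lie_bracket X Y p).
Proof.
move=> sX sY sf Up; have cp := cdom_center p.
have EX := dirder_dirder (X p) sY sf Up; have EY := dirder_dirder (Y p) sX sf Up.
refine (etrans (congr2 (fun a b => a - b) EX EY) _).
have S := Schwarz_rV (X p) (Y p) (chart_open p oU) (mem_chart cp Up) (sf p 2%N).
refine (etrans (congr1 (fun z => z + _ - _) S) _).
rewrite opprD addrACA subrr add0r /lie_bracket.
exact: esym (linear_subr (dirder_linear sf Up) _ _).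
Qed.

(** The components of the bracket are differences of mixed second derivatives of the transition map
    from the chart at c. *)
Lemma bracket_frame (c : M) u w p : cdom c p ->
  lie_bracket (frame c u) (frame c w) p = 0.
Proof.
move=> cp; have cpp := cdom_center p.
have H u' w' : dirder (fun q => dirder (coord p) q (frame c w' q)) p (frame c u' p)
    = 'D_u' ('D_w' (coord p \o cinv c)) (coord c p).
  have oD := openI (cdom_open c) (cdom_open p).
  have s := smooth_frame_dirder c w' (cdom_open p) (@smooth_coord _ _ M p).
  refine (etrans (dirder_frame u' oD s (conj cp cpp) cp) _).
  apply: near_eq_derive; apply: open_near_eq (chart_open c (cdom_open p)) (mem_chart cp cpp) _.
  move=> _ [q [cq pq] <-]; rewrite /comp (coordK cq).
  exact: (dirder_frame w' (cdom_open p) (@smooth_coord _ _ M p) pq cq).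
refine (etrans (congr2 (fun a b => a - b) (H u w) (H w u)) _).
apply/eqP; rewrite subr_eq0; apply/eqP.
apply: (Schwarz_rV u w (chart_open c (cdom_open p)) (mem_chart cp cpp)).
exact: (@smooth_coord _ _ M p c 2%N).
Qed.

End bracket.

End Fields.

(** * Leaves of the kernel of a closed form *)

(** The rows of K form a basis of the kernel of c, and e spans a complement because it pairs to 1
    with c. The dimension m may stay unspecified, as [leaf] admits integral manifolds of any
    dimension. *)
Lemma kernel_parametrization (R : realType) n (c : 'cV[R]_n) (e : 'rV[R]_n) :
  (e *m c) 0 0 = 1 -> exists (m : nat) (K : 'M[R]_(m, n)),
  [/\ forall h : 'rV[R]_m, (h *m K *m c) 0 0 = 0,
     (forall u, exists (h : 'rV[R]_m) a, u = h *m K + a *: e) &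
     forall (h : 'rV[R]_m) a, h *m K + a *: e = 0 -> h = 0].
Proof.
move=> ec; pose K := row_base (kermx c).
have Kc : K *m c = 0 by apply/sub_kermxP; rewrite eq_row_base.
exists (\rank (kermx c)), K; split=> [h|u|h a E].
- by rewrite -mulmxA Kc mulmx0 mxE.
- have : (u - (u *m c) 0 0 *: e <= K)%MS.
    rewrite eq_row_base; apply/sub_kermxP/matrixP => i j; rewrite !ord1.
    rewrite mulmxBl -scalemxAl; move: (u *m c) (e *m c) ec => A B ec.
    by rewrite !mxE ec mulr1 subrr.
  by move=> /submxP[h hE]; exists h, ((u *m c) 0 0); rewrite -hE subrK.
- have a0 : a = 0.
    have /matrixP/(_ 0 0) := congr1 (mulmx^~ c) E.
    rewrite mul0mx mulmxDl -mulmxA Kc mulmx0 add0r -scalemxAl.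
    by move: (e *m c) ec => A ec; rewrite !mxE ec mulr1.
  move: E; rewrite a0 scale0r addr0 => E; apply: (row_free_inj (row_base_free (kermx c))).
  by rewrite mul0mx.
Qed.

Section leaf.
Context {R : realType} n (M : manifold R n) (w : one_form M) (p : M) (e : 'rV[R]_n).
Hypothesis w_linear : forall q, linear (w q).
Hypothesis w_smooth : forall u, smooth_on (cdom p) (fun q => w q (frame p u q) : R).
Hypothesis w_closed : closed_form w.
Hypothesis we : w p e = 1.

Let a0 := coord p p.
Let form (u a : 'rV[R]_n) : R := w (cinv p a) (frame p u (cinv p a)).

Let in_chart : exists2 r : R, 0 < r & forall b, `|b - a0| < r -> (coord p @` cdom p) b.
Proof.
have [d d0 H] := open_nbhs_norm (@cimg_open _ _ M p) (a := a0)
  (ex_intro2 _ _ _ (cdom_center p) erefl).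
by exists d.
Qed.

Lemma form_smooth u : Cinfty_on (coord p @` cdom p) (form u).
Proof. by move=> k; have := w_smooth u p k; rewrite setIid. Qed.

(** On two fields with constant components the bracket vanishes, and closedness becomes equality of
    crossed derivatives. *)
Lemma form_closed u v b : (coord p @` cdom p) b -> 'D_u (form v) b = 'D_v (form u) b.
Proof.
move=> [q pq <-]; have o := cdom_open p.
have su := @smooth_frame _ _ M p u; have sv := @smooth_frame _ _ M p v.
have C := w_closed o su sv pq.
rewrite (bracket_frame u v pq) (linear_zero (@w_linear q)) subr0 in C.
have E1 := dirder_frame u o (w_smooth v) pq pq.
have E2 := dirder_frame v o (w_smooth u) pq pq.
apply/eqP; rewrite -subr_eq0; apply/eqP.
exact: etrans (esym (congr2 (fun a b => a - b) E1 E2)) C.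
Qed.

Lemma form_sum (u b : 'rV[R]_n) : (coord p @` cdom p) b ->
  form u b = \sum_i u 0 i * form (delta_mx 0 i) b.
Proof.
move=> [q pq <-]; rewrite /form coordK//.
rewrite {1}[u]row_sum_delta (linear_big _ _ (frame_linear pq)) (linear_big _ _ (@w_linear q)).
by apply: eq_bigr => i _; rewrite (linear_scale (frame_linear pq)) (linear_scale (@w_linear q)).
Qed.

Lemma local_primitive : exists (r : R) (f : 'rV[R]_n -> R), [/\ 0 < r,
  forall b, `|b - a0| < r -> (coord p @` cdom p) b,
  Cinfty_on [set b | `|b - a0| < r] f &
  forall b u, `|b - a0| < r -> 'D_u f b = form u b].
Proof.
have [r r0 rU] := in_chart.
have dform u b : `|b - a0| < r -> differentiable (form u) b.
  by move=> /rU; exact: Cinfty_diff (form_smooth u).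
have cform u v b : `|b - a0| < r -> {for b, continuous ('D_v (form u) : _ -> R)}.
  move=> /rU br; apply: differentiable_continuous.
  exact: Cinfty_diff (Cinfty_derive v (form_smooth u)) br.
have [r1 [f [r10 r1r H]]] := @Poincare R n (fun i => form (delta_mx 0 i)) a0 r r0
  (fun i => dform _) (fun i u => cform _ u)
  (fun i j b br => form_closed (delta_mx 0 i) (delta_mx 0 j) (rU b br)).
have r1U b : `|b - a0| < r1 -> (coord p @` cdom p) b.
  by move=> h; apply: rU; exact: lt_le_trans h r1r.
have Df b u : `|b - a0| < r1 -> 'D_u f b = form u b.
  by move=> br; have [_ ->] := H b br; rewrite form_sum//; exact: r1U.
(* Beyond continuity, smoothness of f is that of its derivatives, which are the smooth functions
   [form u]. *)
exists r1, f; split=> // -[|k].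
  by move=> b /H[d _]; exact: differentiable_continuous.
split=> [b /H[d _]//|u].
have oB := open_norm_ball a0 r1.
apply: (Ck_eq oB (f := form u)) => [b br|]; first by rewrite Df.
by apply: Ck_sub (form_smooth u k) => b /r1U.
Qed.

Lemma form_center u : form u a0 = w p u.
Proof. by rewrite /form /a0 coordK ?frame_center//; exact: cdom_center. Qed.

(** The level set of the primitive through [coord p p] is a graph over the kernel of [w p] in the
    direction e. Precomposing with [rho] parametrises a piece of it by the whole of
    [rV_manifold m]. *)
Lemma exists_leaf : exists (m : nat) (L : manifold R m) (j : L -> M),
  integral_manifold (kernel_distribution w) j /\ range j p.
Proof.
have [r [f [r0 rU Cf Df]]] := local_primitive.
have c0 : `|a0 - a0| < r by rewrite subrr normr0.
have dfb b : `|b - a0| < r -> differentiable f b by exact: Cinfty_diff Cf.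
pose c : 'cV[R]_n := \col_i form (delta_mx 0 i) a0.
have cE u : (u *m c) 0 0 = w p u.
  rewrite -form_center (form_sum u (rU _ c0)) mxE; apply: eq_bigr => i _.
  by rewrite mxE.
have [m [K [Kc Kspan Kfree]]] := @kernel_parametrization _ _ c e (etrans (cE e) we).
have De : 0 < 'D_e f a0 by rewrite Df// form_center we ltr01.
have [delta [F [delta0 CF F0 HF]]] := implicit_function K r0 Cf De.
have [rho [Crho rhod rho_inj rho0 Drho]] := @ball_parametrization R m delta delta0.
pose phi (y : 'rV[R]_m) := a0 + y *m K + F y *: e.
pose psi := phi \o rho.
have psiP y : [/\ `|psi y - a0| < r, 0 < 'D_e f (psi y) & f (psi y) = f a0].
  by exact: HF (rhod y).
have psiU y : (coord p @` cdom p) (psi y) by apply: rU; have [] := psiP y.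
have oD : open [set y : 'rV[R]_m | `|y| < delta].
  rewrite (_ : [set y | _] = [set y : 'rV[R]_m | `|y - 0| < delta]); first exact: open_norm_ball.
  by apply/seteqP; split=> y /=; rewrite subr0.
have Cphi : Cinfty_on [set y | `|y| < delta] phi.
  move=> k; apply: (Ck_add oD); last by apply: (Ck_scale oD (CF k)); exact: Ck_cst.
  by apply: (Ck_add oD (Ck_cst _ _ _)); exact: (Ck_linear _ _ (mulmxr K)).
have Cpsi : Cinfty_on setT psi.
  by move=> k; exact: (Ck_comp openT oD (fun y _ => rhod y) (Crho k) (Cphi k)).
have dpsi y : differentiable psi y by exact: Cinfty_diff Cpsi (I : setT y).
pose j (y : rV_manifold m) : M := cinv p (psi y).
have jp y : cdom p (j y).
  by rewrite /j; have [q pq <-] := psiU y; rewrite coordK.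
have jK y : coord p (j y) = psi y.
  by rewrite /j; have [q pq <-] := psiU y; rewrite coordK.
have cj : continuous j.
  move=> y; apply: (@continuous_comp _ _ _ psi (cinv p) y).
    exact: differentiable_continuous (dpsi y).
  exact: (@cinv_continuous _ _ M p (psi y)).
have sj : smooth_map j.
  split=> // c1 c' k.
  have o1 : open (j @^-1` cdom c1) by move/continuousP: cj; apply; exact: cdom_open.
  have -> : coord c' @` (cdom c' `&` j @^-1` cdom c1) = j @^-1` cdom c1.
    by apply/seteqP; split=> [_ [y [_ jy] <-]//|y jy]; exists y.
  apply: (Ck_comp (g := coord c1 \o cinv p) o1 (chart_open p (cdom_open c1))).
  - by move=> y jy; rewrite -jK; exact: mem_chart.
  - exact: Ck_sub (Cpsi k).
  - exact: transition_smooth.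
(* [dmap] is read in the chart at [j y], and [frame p] is the change from the chart at p. *)
have dj y u : dmap j y u = frame p ('D_u psi y) (j y).
  have dc : differentiable (coord (j y) \o cinv p) (psi y).
    rewrite -jK; exact: (smooth_on_diff (@smooth_coord _ _ M (j y)) (cdom_center (j y)) (jp y)).
  have E := derive_comp u (dpsi y) dc.
  rewrite /frame jK; exact: E.
have Dpsi y u : 'D_u psi y = ('D_u rho y) *m K + 'D_('D_u rho y) F (rho y) *: e.
  have drho : differentiable rho y by exact: Cinfty_diff Crho (I : setT y).
  have dF : differentiable F (rho y) by exact: Cinfty_diff CF (rhod y).
  have dphi : differentiable phi (rho y) by exact: Cinfty_diff Cphi (rhod y).
  refine (etrans (derive_comp u drho dphi) _).
  move: ('D_u rho y) (rho y) dF => h z dF.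
  have dK : differentiable (fun y : 'rV[R]_m => y *m K) z.
    by apply: (linear_differentiable (f := mulmxr K)); exact: continuous_linear_rV.
  have dFe : differentiable (fun y => F y *: e) z.
    exact: (differentiable_scale dF (differentiable_const e z)).
  have dca : differentiable (fun _ : 'rV[R]_m => a0) z by exact: differentiable_const.
  have E1 := @deriveD _ _ _ (fun y => a0 + y *m K) (fun y => F y *: e) z h
    (diff_derivable (differentiableD dca dK)) (diff_derivable dFe).
  refine (etrans E1 (congr2 (fun a b => a + b) _ _)).
    have E2 := @deriveD _ _ _ (fun=> a0) (fun y => y *m K) z h
      (diff_derivable dca) (diff_derivable dK).
    refine (etrans E2 _); rewrite [X in X + _](_ : _ = 0) ?add0r; last exact: derive_cst.
    rewrite (deriveE _ dK).
    have cK : continuous (mulmxr K : 'rV[R]_m -> 'rV[R]_n) by exact: continuous_linear_rV.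
    exact: (congr1 (fun g => g h) (diff_lin z cK)).
  refine (etrans (derive_scale h dF (differentiable_const e z)) _).
  by rewrite [X in _ *: X + _](_ : _ = 0) ?scaler0 ?add0r//; exact: derive_cst.
(* f is constant along [psi], so the tangent vectors of the graph lie in the kernel of the form. *)
have fpsi y u : 'D_('D_u psi y) f (psi y) = 0.
  have [ry _ _] := psiP y.
  refine (etrans (esym (derive_comp u (dpsi y) (dfb _ ry))) _).
  rewrite (_ : f \o psi = cst (f a0)); first exact: derive_cst.
  by apply/funext => z /=; have [] := psiP z.
have wE y u : w (j y) (frame p u (j y)) = 'D_u f (psi y).
  by have [ry _ _] := psiP y; rewrite Df.
exists m, (rV_manifold m), j; split; last first.
  exists 0 => //; rewrite /j /psi /= rho0 /phi mul0mx addr0 F0 scale0r addr0.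
  by rewrite coordK//; exact: cdom_center.
split.
- split; first exact: sj.
  move=> y u u' E.
  have L := dmap_linear sj y.
  have {}E : dmap j y (u - u') = 0 by rewrite (linear_subr L) E subrr.
  apply/eqP; rewrite -subr_eq0; apply/eqP; have [_] := Drho y; apply.
  move: E; rewrite dj => /(congr1 (comps p (j y))).
  rewrite comps_frame; last exact: jp.
  rewrite (linear_zero (comps_linear (jp y))) Dpsi; exact: Kfree.
- move=> y y' E; apply: rho_inj.
  have : psi y = psi y' by rewrite -!jK E.
  rewrite /psi /= /phi => H; apply/eqP; rewrite -subr_eq0; apply/eqP.
  apply: (Kfree _ (F (rho y) - F (rho y'))).
  have H2 : rho y *m K + F (rho y) *: e = rho y' *m K + F (rho y') *: e.
    by move: H; rewrite -!addrA => /addrI.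
  by rewrite mulmxBl scalerBl addrACA -opprD H2 subrr.
- move=> y; apply/seteqP; split=> [_ [u _ <-]|v wv].
    by rewrite /kernel_distribution /= dj wE fpsi.
  have [ry De' _] := psiP y.
  (* Both h K + s e and h K + (D_h F) e are killed by df. As df(e) > 0 their e-components agree, so
     every kernel vector is tangent to the graph. *)
  have [h [s tE]] := Kspan (comps p (j y) v).
  have [Hs _] := Drho y; have [u uE] := Hs h.
  exists u => //; rewrite dj -[RHS](frame_comps v (jp y)) tE Dpsi uE.
  have L := derive_linear (dfb _ ry).
  have E1 : 'D_h F (rho y) * 'D_e f (psi y) + 'D_(h *m K) f (psi y) = 0.
    have Z := fpsi y u; rewrite Dpsi uE addrC in Z.
    exact: etrans (esym (L _ e (h *m K))) Z.
  have E2 : s * 'D_e f (psi y) + 'D_(h *m K) f (psi y) = 0.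
    have Z : 'D_(s *: e + h *m K) f (psi y) = 0.
      by rewrite addrC -tE -wE frame_comps.
    exact: etrans (esym (L s e (h *m K))) Z.
  have -> : 'D_h F (rho y) = s.
    apply: (mulIf (lt0r_neq0 De')); apply: (addIr ('D_(h *m K) f (psi y))).
    by rewrite E1 E2.
  by [].
Qed.

End leaf.

(** A kernel vector at p is the image under [dmap j] of a vector of the leaf, and alpha is constant
    along j. *)
Lemma dirder_leaf (R : realType) n (M : manifold R n) (w : one_form M) (alpha : M -> R) p e v :
  (forall q, linear (w q)) ->
  (forall u, smooth_on (cdom p) (fun q => w q (frame p u q) : R)) ->
  closed_form w -> w p e = 1 -> smooth_on setT alpha ->
  (forall y, leaf (kernel_distribution w) p y -> alpha y = alpha p) ->
  w p v = 0 -> dirder alpha p v = 0.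
Proof.
move=> wl ws wc we sa al wv.
have [m [L [j [jint [q0 _ jq0]]]]] := exists_leaf wl ws wc we.
have [[sj _] _ /(_ q0) jr] := jint.
have : range (dmap j q0) v by rewrite jr jq0.
move=> [u _ <-]; rewrite -jq0.
refine (etrans (esym (dirder_comp sj u openT sa I)) _).
rewrite (_ : alpha \o j = cst (alpha p)); first exact: dirder_cst.
apply/funext => q1 /=; apply: al; exists m, L, j; split; first exact: jint.
  by exists q0.
by exists q1.
Qed.

(** * Connections along a map *)

#[local] Opaque dirder frame comps.

Section Connections.
Context {R : realType}.
Implicit Types V : normedModType R.

Lemma smooth_on_local n (M : manifold R n) V (U : set M) (f : M -> V) : open U ->
  (forall p, U p -> exists W : set M, [/\ open W, W p & smooth_on W f]) ->
  smooth_on U f.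
Proof.
move=> oU H; apply: smooth_on_chart => // p /H[W [oW Wp sf]].
by exists p, W; split => //; exact: cdom_center.
Qed.

Section along.
Context m n (M : manifold R m) (M' : manifold R n) (x : M -> M').
Context (sx : smooth_map x).
Implicit Types (U : set M) (Z : M -> 'rV[R]_n).

Lemma along_frame U (c : M') u : U `<=` x @^-1` cdom c ->
  smooth_along x U (frame c u \o x).
Proof.
move=> Uc; apply: along_sub Uc _.
exact: (along_field sx (cdom_open c) (@smooth_frame _ _ _ c u)).
Qed.

Lemma smooth_comps (c : M') U Z : open U -> U `<=` x @^-1` cdom c ->
  smooth_along x U Z -> smooth_on U (fun q => comps c (x q) (Z q)).
Proof.
move=> oU Uc sZ.
apply: smooth_on_sub (along_vec sx oU (cdom_open c) sZ (@smooth_coord _ _ M' c)).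
by move=> q Uq; split => //; exact: Uc.
Qed.

(* Z is a combination of the frame fields, with its components as coefficients. *)
Lemma section_ind (c : M') U (Q : (M -> 'rV[R]_n) -> Prop) :
  open U -> U `<=` x @^-1` cdom c ->
  (forall Z Z', (forall q, U q -> Z q = Z' q) -> smooth_along x U Z ->
    smooth_along x U Z' -> Q Z -> Q Z') ->
  (forall Z Z', smooth_along x U Z -> smooth_along x U Z' -> Q Z -> Q Z' ->
    Q (fun q => Z q + Z' q)) ->
  (forall (f : M -> R) Z, smooth_on U f -> smooth_along x U Z -> Q Z -> Q (fun q => f q *: Z q)) ->
  (forall u, Q (frame c u \o x)) ->
  forall Z, smooth_along x U Z -> Q Z.
Proof.
move=> oU Uc Qext Qadd Qscale Qframe Z sZ.
pose Zt q := comps c (x q) (Z q).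
have sZt : smooth_on U Zt by exact: smooth_comps.
pose S r q := \sum_(i <- r) Zt q 0 i *: frame c (delta_mx 0 i) (x q).
have H r : smooth_along x U (S r) /\ Q (S r).
  elim: r => [|i r [IH1 IH2]].
    (* The empty sum is the zero section, recognised as the frame field with components 0. *)
    have E q : U q -> (frame c 0 \o x) q = S [::] q.
      by move=> Uq; rewrite /S big_nil; exact: (linear_zero (frame_linear (Uc _ Uq))).
    have s := along_eq sx oU E (along_frame 0 Uc).
    by split => //; apply: Qext E (along_frame 0 Uc) s _.
  have -> : S (i :: r) = (fun q => Zt q 0 i *: (frame c (delta_mx 0 i) \o x) q + S r q).
    by apply/funext => q; rewrite /S big_cons.
  have sZi := smooth_comp_coord oU i sZt.
  have s1 := along_scale sx oU sZi (along_frame (delta_mx 0 i) Uc).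
  split; first exact: (along_add sx oU s1 IH1).
  exact: (Qadd _ _ s1 IH1 (Qscale _ _ sZi (along_frame _ Uc) (Qframe _)) IH2).
have E q : U q -> S (index_enum 'I_n) q = Z q.
  move=> Uq; have cx := Uc _ Uq; have L := frame_linear cx.
  rewrite -[RHS](frame_comps (Z q) cx) -/(Zt q) [in RHS](row_sum_delta (Zt q)).
  rewrite (linear_big _ _ L) /S; apply: eq_bigr => i _.
  exact: esym (linear_scale L _ _).
by have [s q] := H (index_enum 'I_n); exact: Qext E s sZ q.
Qed.

End along.

Lemma cov_eq m n (M : manifold R m) (M' : manifold R n) (x : M -> M')
  (D : connection_along x) (U : set M) Z Z' p v : open U -> smooth_along x U Z ->
  smooth_along x U Z' -> (forall q, U q -> Z q = Z' q) -> U p -> D p v Z = D p v Z'.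
Proof.
move=> oU sZ sZ' E Up; apply: cov_local oU sZ sZ' _ Up.
by move=> q /set_mem; exact: E.
Qed.

(** Constants have zero derivative, so the Leibniz rule becomes homogeneity. Locality is used
    because frames combine linearly only on the chart domain. *)
Lemma cov_frame_linear n (M : manifold R n) (D : affine_connection M) (c y : M) w :
  cdom c y -> linear (fun u => D y w (frame c u)).
Proof.
move=> cy k a b; have o := cdom_open c.
have s u := @smooth_frame _ _ M c u.
have sk : smooth_on (cdom c) (fun=> k) by exact: smooth_cst.
have sks := along_scale (@smooth_idfun _ _ M) o sk (s a).
have sum := along_add (@smooth_idfun _ _ M) o sks (s b).
have E q : cdom c q -> frame c (k *: a + b) q = k *: frame c a q + frame c b q.
  by move=> cq; exact: (frame_linear cq).
refine (etrans (cov_eq D w o (s _) sum E cy) _).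
refine (etrans (cov_add D w o sks (s b) cy) (congr1 (fun z => z + _) _)).
refine (etrans (cov_leibniz D w o sk (s a) cy) _).
by rewrite dirder_cst scale0r add0r.
Qed.

Lemma cov_frame_add n (M : manifold R n) (D : affine_connection M) (c y : M) w
  (u v : 'rV[R]_n) : cdom c y ->
  D y w (frame c (u + v)) = D y w (frame c u) + D y w (frame c v).
Proof. by move=> cy; exact: (linear_plus (cov_frame_linear D w cy)). Qed.

Lemma cov_frame_scale n (M : manifold R n) (D : affine_connection M) (c y : M) w k
  (u : 'rV[R]_n) : cdom c y -> D y w (frame c (k *: u)) = k *: D y w (frame c u).
Proof. by move=> cy; exact: (linear_scale (cov_frame_linear D w cy)). Qed.

Section pullback.
Context m n (M : manifold R m) (M' : manifold R n) (x : M -> M').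
Context (sx : smooth_map x) (D : affine_connection M') (Dx : connection_along x).
Context (pb : pullback_connection D Dx).

(* The second term differentiates the field of constant components which agrees
   with Z at p. *)
Lemma cov_frame (c : M') (U : set M) Z : open U -> U `<=` x @^-1` cdom c ->
  smooth_along x U Z -> forall p v, U p ->
  Dx p v Z = frame c (dirder (fun q => comps c (x q) (Z q)) p v) (x p) +
     D (x p) (dmap x p v) (frame c (comps c (x p) (Z p))).
Proof.
move=> oU Uc; have st Z0 (sZ : smooth_along x U Z0) := smooth_comps sx oU Uc sZ.
move: Z; apply: (section_ind sx oU Uc) => [Z Z' E sZ sZ' H|Z Z' sZ sZ' H H'|f Z sf sZ H|u] p v Up;
  have cx := Uc _ Up.
- rewrite -(cov_eq Dx v oU sZ sZ' E Up) (H p v Up) (E p Up).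
  refine (congr1 (fun w => frame c w (x p) + _) _).
  by apply: (dirder_eq _ oU Up) => q Uq; rewrite E.
- have E2 := etrans
    (congr1 (fun u => D (x p) (dmap x p v) (frame c u)) (comps_add (Z p) (Z' p) cx))
    (cov_frame_add D (dmap x p v) _ _ cx).
  refine (etrans (cov_add Dx v oU sZ sZ' Up) _).
  refine (etrans (congr2 (fun a b => a + b) (H p v Up) (H' p v Up)) _).
  refine (etrans (addrACA _ _ _ _) (congr2 (fun a b => a + b) _ (esym E2))).
  refine (etrans (esym (frame_add _ _ cx)) _).
  refine (congr1 (fun w => frame c w (x p)) _).
  refine (etrans (esym (dirder_add v (st _ sZ) (st _ sZ') Up)) _).
  by apply: (dirder_eq _ oU Up) => q Uq; rewrite (comps_add _ _ (Uc _ Uq)).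
- have E2 := etrans
    (congr1 (fun u => D (x p) (dmap x p v) (frame c u)) (comps_scale (f p) (Z p) cx))
    (cov_frame_scale D (dmap x p v) _ _ cx).
  refine (etrans (cov_leibniz Dx v oU sf sZ Up) _).
  refine (etrans (congr1 (fun a => _ + f p *: a) (H p v Up)) _).
  rewrite scalerDr addrA.
  refine (congr2 (fun a b => a + b) _ (esym E2)).
  have E3 : dirder f p v *: Z p = frame c (dirder f p v *: comps c (x p) (Z p)) (x p).
    by rewrite (frame_scale _ _ cx) (frame_comps _ cx).
  refine (etrans (congr2 (fun a b => a + b) E3 (esym (frame_scale (f p) _ cx))) _).
  refine (etrans (esym (frame_add _ _ cx)) (congr1 (fun w => frame c w (x p)) _)).
  refine (etrans (addrC _ _) _).
  refine (etrans (esym (dirder_scale v sf (st _ sZ) Up)) _).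
  by apply: (dirder_eq _ oU Up) => q Uq; rewrite (comps_scale _ _ (Uc _ Uq)).
(* The pullback axiom enters here: a pulled-back frame field has constant components, so only the
   second term remains. *)
- refine (etrans (pb v (cdom_open c) (@smooth_frame _ _ M' c u) cx) _).
  rewrite [in RHS]/comp (comps_frame u cx).
  rewrite -[LHS]add0r -(frame0 cx).
  refine (congr1 (fun w => frame c w (x p) + _) _).
  refine (etrans (esym (dirder_cst u p v)) _).
  by apply: (dirder_eq _ oU Up) => q Uq; rewrite comps_frame//; exact: Uc.
Qed.

Section metric.
Context (q : nat) (g : tensor2 M') (gm : semi_riemannian q g) (lc : levi_civita g D).

Lemma metric_add y u v w : g y (u + v) w = g y u w + g y v w.
Proof. by have := metric_linear gm y 1 u v w; rewrite scale1r mul1r. Qed.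

Lemma metric_zero y w : g y 0 w = 0.
Proof. by have /eqP := metric_add y 0 0 w; rewrite addr0 addrC -subr_eq subrr => /eqP. Qed.

Lemma metric_scale y a u w : g y (a *: u) w = a * g y u w.
Proof. by have := metric_linear gm y a u 0 w; rewrite addr0 metric_zero addr0. Qed.

(** Smoothness of g(Z, W) is carried along with the product rule: the induction differentiates f
    g(Z, W), and [metric_smooth] covers fields of M' only. *)
Let compat (U : set M) Z W :=
  smooth_on U (fun p => g (x p) (Z p) (W p) : R) /\
  forall p v, U p -> dirder (fun p => g (x p) (Z p) (W p) : R) p v
    = g (x p) (Dx p v Z) (W p) + g (x p) (Z p) (Dx p v W).

Let compat_sym U Z W : compat U Z W -> compat U W Z.
Proof.
have E : (fun p => g (x p) (Z p) (W p) : R) = (fun p => g (x p) (W p) (Z p) : R).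
  by apply/funext => p; rewrite (metric_sym gm).
rewrite /compat E => -[s H]; split => // p v Up.
by rewrite H// addrC; congr (_ + _); rewrite (metric_sym gm).
Qed.

Let compat_eq U Z Z' W : open U -> smooth_along x U Z -> smooth_along x U Z' ->
  (forall p, U p -> Z p = Z' p) -> compat U Z W -> compat U Z' W.
Proof.
move=> oU sZ sZ' E [s H]; split.
  by apply: smooth_on_eq s => // p Up; rewrite E.
move=> p v Up; rewrite -(cov_eq Dx v oU sZ sZ' E Up) -(E p Up) -(H p v Up).
by apply: dirder_eq oU Up _ => r Ur; rewrite E.
Qed.

Let compat_add U Z Z' W : open U -> smooth_along x U Z -> smooth_along x U Z' ->
  compat U Z W -> compat U Z' W -> compat U (fun p => Z p + Z' p) W.
Proof.
move=> oU sZ sZ' [s H] [s' H'].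
have E : (fun p => g (x p) (Z p + Z' p) (W p) : R) =
  (fun p => g (x p) (Z p) (W p) + g (x p) (Z' p) (W p)).
  by apply/funext => p; rewrite metric_add.
rewrite /compat E; split; first exact: smooth_add.
move=> p v Up; rewrite (dirder_add v s s' Up) (cov_add Dx v oU sZ sZ' Up) (H p v Up) (H' p v Up).
by rewrite !metric_add addrACA.
Qed.

Let compat_scale U (f : M -> R) Z W : open U -> smooth_on U f -> smooth_along x U Z ->
  compat U Z W -> compat U (fun p => f p *: Z p) W.
Proof.
move=> oU sf sZ [s H].
have E : (fun p => g (x p) (f p *: Z p) (W p) : R) =
  (fun p => f p *: (g (x p) (Z p) (W p) : R)).
  by apply/funext => p; rewrite metric_scale.
rewrite /compat E; split; first exact: smooth_scale.
move=> p v Up; rewrite (dirder_scale v sf s Up) (cov_leibniz Dx v oU sf sZ Up) (H p v Up).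
by rewrite metric_add !metric_scale /GRing.scale/=; ring.
Qed.

Let compat_frame U c u w : open U -> U `<=` x @^-1` cdom c ->
  compat U (frame c u \o x) (frame c w \o x).
Proof.
move=> oU Uc; have o := cdom_open c.
have [su sw] := (@smooth_frame _ _ M' c u, @smooth_frame _ _ M' c w).
have s : smooth_on (cdom c) (fun y => g y (frame c u y) (frame c w y) : R).
  exact: (metric_smooth gm o su sw).
split.
  by apply: smooth_on_sub Uc _; exact: (smooth_comp sx o s).
move=> p v Up; have cx := Uc _ Up.
refine (etrans (dirder_comp sx v o s cx) _).
have [_ lc2] := lc.
refine (etrans (lc2 _ _ _ (x p) (dmap x p v) o su sw cx) (esym _)).
exact: (congr2 (fun a b => g (x p) a (frame c w (x p)) + g (x p) (frame c u (x p)) b)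
  (pb v o su cx) (pb v o sw cx)).
Qed.

(** Two nested inductions on sections, on W for fixed Z and then on Z for W a frame field. Symmetry
    of g reduces closure in the second slot to the first. *)
Let compat_chart U c Z W : open U -> U `<=` x @^-1` cdom c ->
  smooth_along x U Z -> smooth_along x U W -> compat U Z W.
Proof.
move=> oU Uc sZ; move: W.
apply: (section_ind sx oU Uc) => [W W' E sW sW' H|W W' sW sW' H H'|f W sf sW H|u].
- by apply: compat_sym; apply: compat_eq E (compat_sym H).
- by apply: compat_sym; apply: compat_add => //; exact: compat_sym.
- by apply: compat_sym; apply: compat_scale => //; exact: compat_sym.
move: Z sZ; apply: (section_ind sx oU Uc) => [W W' E sW sW' H|W W' sW sW' H H'|f W sf sW H|w].
- exact: compat_eq E H.
- exact: compat_add.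
- exact: compat_scale.
- exact: compat_frame.
Qed.

Lemma pullback_metric U Z W : open U -> smooth_along x U Z -> smooth_along x U W ->
  smooth_on U (fun p => g (x p) (Z p) (W p) : R) /\
  forall p v, U p -> dirder (fun p => g (x p) (Z p) (W p) : R) p v
    = g (x p) (Dx p v Z) (W p) + g (x p) (Z p) (Dx p v W).
Proof.
move=> oU sZ sW.
have H p : U p -> exists U' : set M, [/\ open U', U' p & compat U' Z W].
  move=> Up; have oD : open (U `&` x @^-1` cdom (x p)).
    by apply: openI => //; apply: smooth_map_open => //; exact: cdom_open.
  exists (U `&` x @^-1` cdom (x p)); split => //.
    by split => //; exact: cdom_center.
  have UU : U `&` x @^-1` cdom (x p) `<=` U by move=> r [].
  have Uc : U `&` x @^-1` cdom (x p) `<=` x @^-1` cdom (x p) by move=> r [].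
  exact: (compat_chart oD Uc (along_sub UU sZ) (along_sub UU sW)).
split.
  by apply: smooth_on_local => // p /H[U' [oU' Up [s _]]]; exists U'.
by move=> p v /H[U' [oU' Up [_ E]]]; exact: E.
Qed.

End metric.

(** In the expansion of [cov_frame], the derivatives of the components give the bracket by
    [dirder_bracket], and the terms in D cancel because D is torsion free and frame fields
    commute. *)
Lemma pullback_torsion (g : tensor2 M') (U : set M) X Y p : levi_civita g D -> open U ->
  smooth_field U X -> smooth_field U Y -> U p ->
  Dx p (X p) (fun r => dmap x r (Y r)) - Dx p (Y p) (fun r => dmap x r (X r))
  = dmap x p (lie_bracket X Y p).
Proof.
move=> [lc _] oU sX sY Up; set c := x p; have o := cdom_open c.
have oD : open (U `&` x @^-1` cdom c) by apply: openI => //; exact: smooth_map_open.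
set U' := U `&` _ in oD.
have Up' : U' p by split => //; exact: cdom_center.
have Uc : U' `<=` x @^-1` cdom c by move=> r [].
have UU : U' `<=` U by move=> r [].
have sX' := along_sub UU sX; have sY' := along_sub UU sY.
have scx : smooth_on U' (coord c \o x).
  by apply: smooth_on_sub Uc _; exact: (smooth_comp sx o (@smooth_coord _ _ M' c)).
have F A v : smooth_field U' A -> Dx p v (fun r => dmap x r (A r)) =
   dirder (fun r => dirder (coord c \o x) r (A r)) p v +
   D c (dmap x p v) (frame c (dmap x p (A p))).
  move=> sA; rewrite (cov_frame oD Uc (along_dmap sx oD sA) v Up') frame_center.
  rewrite comps_center; refine (congr1 (fun w => w + _) _).
  by apply: (dirder_eq _ oD Up') => r Ur; exact: comps_dmap (Uc _ Ur).
rewrite (F Y _ sY') (F X _ sX') opprD addrACA.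
rewrite (dirder_bracket oD sX' sY' scx Up') -[RHS]addr0; congr (_ + _).
set a := dmap x p (X p); set b := dmap x p (Y p).
have := lc (cdom c) (frame c a) (frame c b) c o (@smooth_frame _ _ M' c a)
  (@smooth_frame _ _ M' c b) (cdom_center c).
by rewrite !frame_center bracket_frame//; exact: cdom_center.
Qed.

End pullback.

End Connections.

(** * Null hypersurfaces *)

#[local] Opaque dmap cov.

Lemma bilinear_expand (R : realType) (V : lmodType R) (h : V -> V -> R) :
  (forall u v w, h (u + v) w = h u w + h v w) ->
  (forall a u w, h (a *: u) w = a * h u w) -> (forall u v, h u v = h v u) ->
  forall a b c y z s t, h (a + s *: c) z + h y (b + t *: c) =
    h a z + h y b + s * h c z + t * h c y.
Proof.
move=> hD hZ hC a b c y z s t; rewrite hD hZ (hC y) hD hZ (hC b).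
by rewrite -!addrA; congr (_ + _); rewrite addrCA.
Qed.

Lemma closed_arith (R : realType) (t e1 e2 G t2 : R) :
  - 0 + t * 1 + e1 - (- G + t2 * 0 + e2) - (e1 - e2) = 0 -> t = - G.
Proof. by lra. Qed.

Lemma associated_arith (R : realType) (G1 G2 b1 b2 y z al da dy dz y' z' g1 g2 t : R) :
  dy = - g1 + t * y + y' -> dz = - g2 + t * z + z' ->
  G1 + G2 + b1 * z + b2 * y + (al * (y * dz + dy * z) + da * (y * z))
  = G1 + al * (y' * z) + (G2 + al * (y * z')) + (b1 - al * g1) * z + (b2 - al * g2) * y
    + (da + 2 * al * t) * (y * z).
Proof. by move=> -> ->; ring. Qed.

Lemma cancel_arith (R : realType) (a b c d : R) : a = a + b + c + d -> b + c + d = 0.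
Proof. by lra. Qed.

Lemma dirder_zero (R : realType) n (M : manifold R n) (f : M -> R) p v :
  (forall r, f r = 0) -> dirder f p v = 0.
Proof. by move=> h; rewrite (_ : f = (fun=> 0)) ?dirder_cst//; exact/funext. Qed.

Section Null.
Context (R : realType) (n q : nat)
    (Mb : manifold R n.+1) (gb : tensor2 Mb) (Db : affine_connection Mb)
    (M : manifold R n) (x : M -> Mb) (Dx : connection_along x)
    (Om : set Mb) (N : Mb -> 'rV[R]_n.+1) (xi : M -> 'rV[R]_n)
    (nabla : affine_connection M) (B : tensor2 M)
    (AN Axi : M -> 'rV[R]_n -> 'rV[R]_n) (tau : one_form M)
    (gb_metric : semi_riemannian q gb)
    (Db_levi_civita : levi_civita gb Db)
    (M_null : null_hypersurface x gb)
    (Dx_pullback : pullback_connection Db Dx)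
    (N_rigging : null_rigging x gb Om N)
    (xi_rigged : rigged_field x gb N xi)
    (induced : induced_objects gb Db Dx N xi nabla B AN Axi tau).

Notation g := (induced_tensor x gb).
Notation eta := (rigging_form x gb N).

Let sx : smooth_map x. Proof. by have [[[]]] := M_null. Qed.
Let dx_inj p : injective (dmap x p). Proof. by have [[[_ h] _ _] _] := M_null; exact: h. Qed.

Let gbD y u v w := metric_add gb_metric y u v w.
Let gbZ y a u w := metric_scale gb_metric y a u w.
Let gbC y u v := metric_sym gb_metric y u v.

Lemma induced_sym p u v : g p u v = g p v u. Proof. exact: gbC. Qed.

Lemma induced_add p u v w : g p (u + v) w = g p u w + g p v w.
Proof. by rewrite /induced_tensor (dmap_add sx) gbD. Qed.

Lemma induced_scale p a u w : g p (a *: u) w = a * g p u w.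
Proof. by rewrite /induced_tensor (dmap_scale sx) gbZ. Qed.

Lemma induced_sub p u v w : g p (u - v) w = g p u w - g p v w.
Proof. by rewrite -scaleN1r induced_add induced_scale mulN1r. Qed.

Lemma induced_opp p u w : g p (- u) w = - g p u w.
Proof. by rewrite -scaleN1r induced_scale mulN1r. Qed.

Lemma rigging_add p u v : eta p (u + v) = eta p u + eta p v.
Proof. by rewrite /rigging_form (dmap_add sx) gbC gbD !(gbC _ (N _)). Qed.

Lemma rigging_scale p a u : eta p (a *: u) = a * eta p u.
Proof. by rewrite /rigging_form (dmap_scale sx) gbC gbZ gbC. Qed.

Lemma rigging_sub p u v : eta p (u - v) = eta p u - eta p v.
Proof. by rewrite -scaleN1r rigging_add rigging_scale mulN1r. Qed.

Lemma smooth_rigged_field (U : set M) : smooth_field U xi.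
Proof. by have [s _ _] := xi_rigged; apply: along_sub s. Qed.

Lemma induced_xi p v : g p (xi p) v = 0.
Proof. by have [_ h _] := xi_rigged; exact: h. Qed.

Lemma rigging_xi p : eta p (xi p) = 1.
Proof. by have [_ _ h] := xi_rigged; rewrite /rigging_form gbC. Qed.

Lemma smooth_rigging : smooth_along x setT (N \o x).
Proof.
have [oOm sOm s _ _] := N_rigging.
apply: along_sub (along_field sx oOm s) => p _; apply: sOm; by exists p.
Qed.

Lemma cov_rigging p v : Dx p v (N \o x) = - dmap x p (AN p v) + tau p v *: N (x p).
Proof.
have [oOm sOm s _ _] := N_rigging; have [_ w _ _ _] := induced.
have h : Om (x p) by apply: sOm; exists p.
exact: etrans (Dx_pullback v oOm s h) (w p v).
Qed.

Section fields.
Context (U : set M) (oU : open U).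

Let smooth_dmap Y : smooth_field U Y -> smooth_along x U (fun r => dmap x r (Y r)).
Proof. exact: along_dmap. Qed.

Let smooth_N : smooth_along x U (N \o x).
Proof. exact: along_sub smooth_rigging. Qed.

Let gbN y u v : gb y (- u) v = - gb y u v.
Proof. by rewrite -scaleN1r gbZ mulN1r. Qed.

(** Weingarten for N and Gauss for Y; the B-term drops out because N is lightlike. *)
Lemma rigging_deriv Y p v : smooth_field U Y -> U p ->
  dirder (fun r => eta r (Y r) : R) p v =
    - g p (AN p v) (Y p) + tau p v * eta p (Y p) + eta p (nabla p v Y).
Proof.
move=> sY Up; have [_ H] := pullback_metric sx Dx_pullback gb_metric Db_levi_civita oU
  smooth_N (smooth_dmap sY).
have [G _ _ _ _] := induced.
refine (etrans (H p v Up) _).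
have [_ N0] := rigging_lightlike N_rigging p.
refine (etrans (congr2 (fun a b => gb (x p) a (dmap x p (Y p)) + gb (x p) (N (x p)) b)
  (cov_rigging p v) (G U Y p v oU sY Up)) _).
rewrite gbD gbN gbZ; congr (_ + _).
by rewrite gbC gbD gbZ N0 mulr0 addr0 gbC.
Qed.

Lemma smooth_rigging_form Y : smooth_field U Y -> smooth_on U (fun r => eta r (Y r) : R).
Proof.
move=> sY; by have [s _] := pullback_metric sx Dx_pullback gb_metric Db_levi_civita oU
  smooth_N (smooth_dmap sY).
Qed.

Lemma smooth_induced Y Z : smooth_field U Y -> smooth_field U Z ->
  smooth_on U (fun r => g r (Y r) (Z r) : R).
Proof.
move=> sY sZ; by have [s _] := pullback_metric sx Dx_pullback gb_metric Db_levi_civita oU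
  (smooth_dmap sY) (smooth_dmap sZ).
Qed.

(** The N-components in the Gauss formula pair with tangent vectors to give eta, which leaves the
    two B-terms. *)
Lemma induced_deriv Y Z p v : smooth_field U Y -> smooth_field U Z -> U p ->
  dirder (fun r => g r (Y r) (Z r) : R) p v =
    g p (nabla p v Y) (Z p) + g p (Y p) (nabla p v Z)
    + B p v (Y p) * eta p (Z p) + B p v (Z p) * eta p (Y p).
Proof.
move=> sY sZ Up; have [_ H] := pullback_metric sx Dx_pullback gb_metric Db_levi_civita oU
  (smooth_dmap sY) (smooth_dmap sZ).
have [G _ _ _ _] := induced.
refine (etrans (H p v Up) _).
refine (etrans (congr2
  (fun a b => gb (x p) a (dmap x p (Z p)) + gb (x p) (dmap x p (Y p)) b)
  (G U Y p v oU sY Up) (G U Z p v oU sZ Up)) _).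
exact: (bilinear_expand (gbD (x p)) (gbZ (x p)) (gbC (x p))).
Qed.

(** The torsion identity along x splits into a tangential and an N-component; both vanish because N
    is transverse and [dmap x p] injective. *)
Lemma torsion_free X Y p : smooth_field U X -> smooth_field U Y -> U p ->
  nabla p (X p) Y - nabla p (Y p) X = lie_bracket X Y p /\
  B p (X p) (Y p) = B p (Y p) (X p).
Proof.
move=> sX sY Up; have [G _ _ _ _] := induced.
have T := pullback_torsion sx Dx_pullback Db_levi_civita oU sX sY Up.
have {}T := etrans (esym (congr2 (fun a b => a - b)
  (G U Y p (X p) oU sY Up) (G U X p (Y p) oU sX Up))) T.
move: (nabla p _ Y) (nabla p _ X) (lie_bracket X Y p) (B p (X p) (Y p)) (B p (Y p) (X p)) T.
move=> w1 w2 w3 b1 b2 T.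
have E : dmap x p (w1 - w2 - w3) = (b2 - b1) *: N (x p).
  rewrite !(dmap_sub sx) -T; move: (dmap x p w1) (dmap x p w2) (N (x p)) => c1 c2 c3.
  by apply/rowP => i; rewrite !mxE; ring.
have b12 : b1 = b2.
  apply/eqP; rewrite eq_sym -subr_eq0; apply: contraT => b0.
  have [_ _ _ t _] := N_rigging; case: (t p).
  exists ((b2 - b1)^-1 *: (w1 - w2 - w3)) => //.
  by rewrite (dmap_scale sx) E scalerA mulVf// scale1r.
split=> //; apply/eqP; rewrite -subr_eq0; apply/eqP; apply: (dx_inj (p := p)).
by rewrite E b12 subrr scale0r (dmap0 sx).
Qed.

End fields.

(** Differentiating g(xi, xi) = 0 leaves 2 B(v, xi). *)
Lemma B_xi p v : B p v (xi p) = 0.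
Proof.
have := etrans (esym (dirder_zero p v (fun r => induced_xi r (xi r))))
  (induced_deriv openT v (smooth_rigged_field setT) (smooth_rigged_field setT) I).
rewrite induced_sym !induced_xi !add0r rigging_xi mulr1 => /esym/eqP.
by rewrite -mulr2n mulrn_eq0/= => /eqP.
Qed.

(** Differentiate g(u, xi) = 0 with u extended as a frame field, and replace the derivative of xi by
    its Weingarten formula; its xi-component is invisible to g. *)
Lemma B_Axi p v u : B p v u = g p (Axi p v) u.
Proof.
have [_ _ w _ _] := induced.
have h := induced_deriv (cdom_open p) v (@smooth_frame _ _ M p u)
  (smooth_rigged_field (cdom p)) (cdom_center p).
have h0 r : g r (frame p u r) (xi r) = 0 by rewrite induced_sym induced_xi.
have {}h := etrans (esym (dirder_zero p v h0)) h.
rewrite frame_center rigging_xi B_xi mulr1 mul0r addr0 induced_sym induced_xi add0r w in h.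
move/esym/eqP: h; rewrite induced_sym induced_sub induced_opp induced_scale induced_xi mulr0 subr0.
by rewrite addrC subr_eq0 => /eqP.
Qed.

Lemma B_sym p u v : B p u v = B p v u.
Proof.
have [_ ] := torsion_free (cdom_open p) (@smooth_frame _ _ M p u) (@smooth_frame _ _ M p v)
  (cdom_center p).
by rewrite !frame_center.
Qed.

(** A dimension count: the matrix of [dmap x p] with the row N added is square of size n + 1, and
    transversality makes its rows independent. *)
Lemma tangent_plus_rigging p (z : 'rV[R]_n.+1) : exists u a, z = dmap x p u + a *: N (x p).
Proof.
have lin := dmap_linear sx p.
pose dM := GRing.isLinear.Build _ _ _ _ _ lin.
pose dL : {linear 'rV[R]_n -> 'rV[R]_n.+1} := HB.pack (dmap x p) dM.
pose A := lin1_mx dL.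
have AE u : u *m A = dmap x p u by exact: mul_rV_lin1.
pose C := col_mx A (N (x p)).
have CE u (a : 'M[R]_1) : row_mx u a *m C = dmap x p u + a 0 0 *: N (x p).
  by rewrite mul_row_col AE {1}[a]mx11_scalar mul_scalar_mx.
have free : row_free C.
  apply: inj_row_free => v; rewrite -[v]hsubmxK CE => E.
  have a0 : rsubmx v 0 0 = 0.
    apply/eqP; apply: contraT => a0.
    have [_ _ _ t _] := N_rigging; case: (t p).
    exists (- (rsubmx v 0 0)^-1 *: lsubmx v) => //.
    move/eqP: E; rewrite addr_eq0 => /eqP E.
    by rewrite (dmap_scale sx) E scaleNr scalerN opprK scalerA mulVf// scale1r.
  have u0 : lsubmx v = 0.
    by apply: (dx_inj (p := p)); rewrite (dmap0 sx); move: E; rewrite a0 scale0r addr0.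
  by rewrite u0 [rsubmx v]mx11_scalar a0 raddf0 row_mx0.
have full : row_full C by rewrite /row_full (eqP free) addn1.
have /submxP[D ->] := submx_full z full.
by exists (lsubmx D), (rsubmx D 0 0); rewrite -CE hsubmxK.
Qed.

(** Such a w is orthogonal to N and to the tangent space of M, hence to the whole ambient tangent
    space. *)
Lemma screen_nondegenerate p w : eta p w = 0 -> (forall u, g p w u = 0) -> w = 0.
Proof.
move=> ew gw; apply: (dx_inj (p := p)); rewrite (dmap0 sx).
apply: (@metric_nondegenerate _ _ _ _ _ gb_metric (x p)) => z.
have [u [a ->]] := tangent_plus_rigging p z.
have ew' : gb (x p) (N (x p)) (dmap x p w) = 0 by exact: ew.
rewrite gbC gbD gbZ ew' mulr0 addr0 gbC; exact: gw.
Qed.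

Lemma Axi_xi p : Axi p (xi p) = 0.
Proof.
have [_ _ _ _ h] := induced; apply: (@screen_nondegenerate p); first exact: h.
by move=> v; rewrite -B_Axi B_sym B_xi.
Qed.

(** Pairing the Weingarten formula with xi, which is orthogonal to TM and has product 1 with N,
    recovers tau(v) from the derivative of N. *)
Lemma tau_linear p : linear (tau p).
Proof.
have E v : tau p v = gb (x p) (Dx p v (N \o x)) (dmap x p (xi p)).
  have e1 : gb (x p) (N (x p)) (dmap x p (xi p)) = 1 by exact: rigging_xi.
  have e2 : gb (x p) (dmap x p (AN p v)) (dmap x p (xi p)) = 0 by rewrite gbC; exact: induced_xi.
  by rewrite cov_rigging gbD gbZ -scaleN1r gbZ e1 e2 mulr0 add0r mulr1.
by move=> a u v; rewrite !E (cov_linear Dx a u v openT smooth_rigging I) gbD gbZ.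
Qed.

Section closed.
Context (closed_rigging : closed_form eta).

(** d eta is evaluated on v, extended as a frame field, and xi. Writing the bracket through nabla
    cancels the connection terms and leaves tau(v) + g(AN xi, v). *)
Lemma tau_screen p v : eta p v = 0 -> tau p v = - g p (AN p (xi p)) v.
Proof.
move=> ev; have o := cdom_open p; have sv := @smooth_frame _ _ M p v.
have cp := cdom_center p.
have C := closed_rigging o sv (smooth_rigged_field _) cp.
have [T _] := torsion_free o sv (smooth_rigged_field _) cp.
have E1 := rigging_deriv o (frame p v p) (smooth_rigged_field _) cp.
have E2 := rigging_deriv o (xi p) sv cp.
rewrite -T in C.
rewrite rigging_sub in C.
have {}C := etrans (esym (congr2 (fun a b => a - b -
  (eta p (nabla p (frame p v p) xi) - eta p (nabla p (xi p) (frame p v)))) E1 E2)) C.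
rewrite frame_center rigging_xi ev (induced_sym _ _ (xi p)) induced_xi in C.
exact: closed_arith C.
Qed.

End closed.

(** * The associated metric and its Levi-Civita condition *)

Section associated.
Context (alpha : M -> R) (s_alpha : smooth_on setT alpha).

Notation ga := (associated_metric x gb N alpha).

Lemma associated_deriv U Y Z p v : open U -> smooth_field U Y -> smooth_field U Z -> U p ->
  dirder (fun r => ga r (Y r) (Z r) : R) p v =
    ga p (nabla p v Y) (Z p) + ga p (Y p) (nabla p v Z)
    + (g p (Axi p v) (Y p) - alpha p * g p (AN p v) (Y p)) * eta p (Z p)
    + (g p (Axi p v) (Z p) - alpha p * g p (AN p v) (Z p)) * eta p (Y p)
    + (dirder alpha p v + 2 * alpha p * tau p v) * (eta p (Y p) * eta p (Z p)).
Proof.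
move=> oU sY sZ Up; have sa : smooth_on U alpha by exact: smooth_on_sub s_alpha.
have seY := smooth_rigging_form oU sY; have seZ := smooth_rigging_form oU sZ.
have see := smooth_scale oU seY seZ.
have sae := smooth_scale oU sa see.
refine (etrans (dirder_add v (smooth_induced oU sY sZ) sae Up) _).
have E := etrans (dirder_scale v sa see Up) (congr1
  (fun a => alpha p *: a + dirder alpha p v *: (eta p (Y p) *: eta p (Z p)))
  (dirder_scale v seY seZ Up)).
refine (etrans (congr2 (fun a b => a + b) (induced_deriv oU v sY sZ Up) E) _).
have [E1 E2] := (rigging_deriv oU v sY Up, rigging_deriv oU v sZ Up).
rewrite -!B_Axi; exact: associated_arith E1 E2.
Qed.

Lemma levi_civita_associated : levi_civita ga nabla <->
  forall p v, Axi p v = alpha p *: AN p v /\ dirder alpha p v + 2 * alpha p * tau p v = 0.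
Proof.
split=> [[_ H] p v|H].
  have o := cdom_open p; have cp := cdom_center p.
  pose C u := g p (Axi p v) u - alpha p * g p (AN p v) u.
  pose T := dirder alpha p v + 2 * alpha p * tau p v.
  have K u w : C u * eta p w + C w * eta p u + T * (eta p u * eta p w) = 0.
    have [su sw] := (@smooth_frame _ _ M p u, @smooth_frame _ _ M p w).
    have E := etrans (esym (H _ _ _ p v o su sw cp)) (associated_deriv v o su sw cp).
    by have := cancel_arith E; rewrite !frame_center.
  have Cxi : C (xi p) = 0 by rewrite /C !(induced_sym _ _ (xi p)) !induced_xi mulr0 subrr.
  (* The pair (xi, xi) isolates T, and then (u, xi) isolates C u. *)
  have T0 : T = 0 by have := K (xi p) (xi p); rewrite Cxi rigging_xi !mul0r !add0r !mulr1.
  have C0 u : C u = 0.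
    by have := K u (xi p); rewrite Cxi rigging_xi T0 !mul0r !addr0 mulr1.
  split=> //; apply/eqP; rewrite -subr_eq0; apply/eqP; apply: (@screen_nondegenerate p).
    have [_ _ _ hN hX] := induced.
    have [e1 e2] : eta p (AN p v) = 0 /\ eta p (Axi p v) = 0 by split; [exact: hN|exact: hX].
    by rewrite rigging_sub rigging_scale e1 e2 mulr0 subr0.
  by move=> u; rewrite induced_sub induced_scale; exact: C0.
split.
  move=> U X Y p oU sX sY Up; have [h _] := torsion_free oU sX sY Up; exact: h.
move=> U Y Z p v oU sY sZ Up.
have [H1 H2] := H p v.
refine (etrans (associated_deriv v oU sY sZ Up) _).
by rewrite H1 H2 !induced_scale !subrr !mul0r !addr0.
Qed.

End associated.

End Null.

Theorem theorem3p2 (R : realType) (n q : nat)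
    (Mb : manifold R n.+1) (gb : tensor2 Mb) (Db : affine_connection Mb)
    (M : manifold R n) (x : M -> Mb) (Dx : connection_along x)
    (Om : set Mb) (N : Mb -> 'rV[R]_n.+1) (xi : M -> 'rV[R]_n)
    (nabla : affine_connection M) (B : tensor2 M)
    (AN Axi : M -> 'rV[R]_n -> 'rV[R]_n) (tau : one_form M)
    (q_gt0 : (0 < q)%N)
    (gb_metric : semi_riemannian q gb)
    (Db_levi_civita : levi_civita gb Db)
    (M_null : null_hypersurface x gb)
    (Dx_pullback : pullback_connection Db Dx)
    (N_rigging : null_rigging x gb Om N)
    (xi_rigged : rigged_field x gb N xi)
    (induced : induced_objects gb Db Dx N xi nabla B AN Axi tau)
    (closed_rigging : closed_form (rigging_form x gb N)) :
  (forall alpha : M -> R,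
     smooth_on setT alpha ->
     (forall p, alpha p != 0) ->
     (forall p y, leaf (kernel_distribution (rigging_form x gb N)) p y ->
        alpha y = alpha p) ->
     (levi_civita (associated_metric x gb N alpha) nabla <->
      (forall p v, Axi p v = alpha p *: AN p v) /\
      (forall p, 2 * alpha p * tau p (xi p) + dirder alpha p (xi p) = 0)))
  /\
  (forall a : R, a != 0 ->
     (levi_civita (associated_metric x gb N (fun=> a)) nabla <->
      (forall p v, Axi p v = a *: AN p v) /\
      (forall p v, tau p v = 0))).
Proof.
have lc alpha (sa : smooth_on setT alpha) :=
  levi_civita_associated gb_metric Db_levi_civita M_null Dx_pullback N_rigging xi_rigged induced sa.
split=> [alpha sa a0 al|a a0]; last first.
  apply: iff_trans (lc _ _) _; first exact: smooth_cst.
  split=> [H|[H1 H2] p v].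
    split=> p v; have [h1 h2] := H p v; first exact: h1.
    move: h2; rewrite dirder_cst add0r => /eqP.
    by rewrite -mulrA mulf_eq0 pnatr_eq0/= mulf_eq0 (negbTE a0) => /eqP.
  by rewrite H1 H2 mulr0 addr0 dirder_cst.
apply: iff_trans (lc _ sa) _; split=> [H|[H1 H2] p v].
  split=> [p v|p]; first by have [] := H p v.
  by rewrite addrC; have [] := H p (xi p).
split; first exact: H1.
have etaxi := rigging_xi gb_metric xi_rigged.
have wl r : linear (rigging_form x gb N r).
  by move=> k u w; rewrite (rigging_add N gb_metric M_null) (rigging_scale N gb_metric M_null).
have ws u := smooth_rigging_form gb_metric Db_levi_civita M_null Dx_pullback N_rigging
  (cdom_open p) (@smooth_frame _ _ M p u).
have screen w : rigging_form x gb N p w = 0 ->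
    dirder alpha p w + 2 * alpha p * tau p w = 0.
  move=> ew; rewrite (dirder_leaf wl ws closed_rigging (etaxi p) sa (al p) ew) add0r.
  rewrite (tau_screen gb_metric Db_levi_civita M_null Dx_pullback N_rigging xi_rigged induced
    closed_rigging ew).
  have AN0 : AN p (xi p) = 0.
    apply: (scalerI (a0 p)); rewrite -H1 scaler0.
    exact: (Axi_xi gb_metric Db_levi_civita M_null Dx_pullback N_rigging xi_rigged induced).
  by rewrite AN0 -(scale0r (0 : 'rV[R]_n)) (induced_scale gb_metric M_null) mul0r oppr0 mulr0.
pose T w := dirder alpha p w + 2 * alpha p * tau p w.
have TL : linear T.
  have L1 := dirder_linear (p := p) sa I.
  have L2 := tau_linear gb_metric M_null Dx_pullback N_rigging xi_rigged induced p.
  move=> k u w; rewrite /T L1 L2 /GRing.scale/=.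
  by move: (dirder alpha p u) (dirder alpha p w) => *; ring.
(* v splits into the screen vector v - eta(v) xi and eta(v) xi; the scalar condition along xi
   disposes of the latter. *)
rewrite -/(T v) -[v](subrK (rigging_form x gb N p v *: xi p)).
rewrite (linear_plus TL) (linear_scale TL).
rewrite {1}/T screen ?add0r; last first.
  by rewrite (linear_subr (wl p)) (linear_scale (wl p)) etaxi /GRing.scale/= mulr1 subrr.
by rewrite /T addrC H2 scaler0.
Qed.
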